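(* In the warped-product Lovelock setting of the context, suppose that the field equations $\mathcal G_{\mu\nu}=T_{\mu\nu}$ hold and that $T_{\mu\nu}$ satisfies the dominant energy condition. Then the quasilocal mass $M$ is nondecreasing along outgoing null or spacelike directions on an untrapped surface. That is, at every point of $M^2$ at which $\theta_+>0$ and $\theta_-<0$, one has $\xi^aD_aM\ge 0$ for every vector $\xi=\xi^v\partial_v+\xi^u\partial_u$ with $\xi^v\ge 0$ and $\xi^u\le 0$.
   Context: Let $n\ge 4$, $D=n+2$, $k=\lfloor (D-1)/2\rfloor=\lfloor (n+1)/2\rfloor$, and let $a_1=1,a_2,\dots,a_k$ and $\Lambda$ be real constants. Let $(M^2,g_{ab})$ be a smooth, oriented, time-oriented two-dimensional Lorentzian manifold with Levi-Civita derivative $D_a$, and let $r>0$ be a smooth function on $M^2$. Let $(\mathcal K^n,\gamma_{ij})$ be a compact $n$-dimensional Riemannian Einstein manifold with $R_{ij}[\gamma]=(n-1)\kappa\gamma_{ij}$, $\kappa\in\{-1,0,1\}$, and volume $V_n^\kappa$. The spacetime is $M^2\times\mathcal K^n$ with metric $ds^2=g_{ab}(y)dy^ady^b+r^2(y)\gamma_{ij}(x)dx^idx^j$. Write $(Dr)^2=g^{ab}D_arD_br$. The symbol $\delta^{\mu_1\cdots\mu_s}_{\nu_1\cdots\nu_s}=\det(\delta^{\mu_i}_{\nu_j})$ is the generalized Kronecker delta (no factorial normalization). Let $C_{ij}{}^{kl}=R_{ij}{}^{kl}[\gamma]-\kappa\,\delta^{kl}_{ij}$ be the Weyl tensor of $\gamma$.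 Put $W(0)=1$, $W(0)^i{}_j=\delta^i_j$ and, for $s\ge1$, $$W(s)=\delta^{i_1\cdots i_{2s}}_{j_1\cdots j_{2s}}C_{i_1i_2}{}^{j_1j_2}\cdots C_{i_{2s-1}i_{2s}}{}^{j_{2s-1}j_{2s}},\qquad W(s)^i{}_j=\delta^{i\,i_1\cdots i_{2s}}_{j\,j_1\cdots j_{2s}}C_{i_1i_2}{}^{j_1j_2}\cdots C_{i_{2s-1}i_{2s}}{}^{j_{2s-1}j_{2s}}.$$ Standing assumption: for all $m$, $W(m)^i{}_j=\frac{n-2m}{n}\delta^i_jW(m)$ and $W(m)$ is constant on $\mathcal K^n$. The Lovelock tensor is $$\mathcal G^\mu{}_\nu=-\sum_{m=1}^k\frac{1}{2^{m+1}}\frac{a_m}{m}\delta^{\mu\rho_1\cdots\rho_{2m}}_{\nu\sigma_1\cdots\sigma_{2m}}R_{\rho_1\rho_2}{}^{\sigma_1\sigma_2}\cdots R_{\rho_{2m-1}\rho_{2m}}{}^{\sigma_{2m-1}\sigma_{2m}}+\Lambda\delta^\mu_\nu ,$$ and the field equations are $\mathcal G_{\mu\nu}=T_{\mu\nu}$, where $T_{\mu\nu}dx^\mu dx^\nu=T_{ab}(y)dy^ady^b+r^2(y)p(y)\gamma_{ij}dx^idx^j$. The quasilocal mass is the function on $M^2$ $$M=V_n^\kappa\Big[\sum_{m=1}^k\frac{a_m}{2^{m+1}m}\frac{r^{n-2m+1}}{n-2m+1}W(m)-\frac{r^{n+1}}{n+1}\Lambda+\sum_{m=1}^k\sum_{l=0}^{m-1}a_m2^{l-m}\frac{r^{n-2m+1}}{l+1}\binom{m-1}{l}\Big(\prod_{p=0}^{2l}(n-2m+2+p)\Big)(\kappa-(Dr)^2)^{l+1}W(m-1-l)\Big],$$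 where a term with $n-2m+1=0$ in the first sum is omitted (then $W(m)=0$ since $2m>n$). Local double null coordinates on $M^2$: $g_{ab}dy^ady^b=-2e^{-f(u,v)}du\,dv$, with $\partial_u,\partial_v$ future-directed, $\partial_v$ being called outgoing and $\partial_u$ ingoing. The expansions are $\theta_+=n\,\partial_vr/r$ and $\theta_-=n\,\partial_ur/r$. A surface $\{y\}\times\mathcal K^n$ is untrapped if $\theta_+>0$ and $\theta_-<0$ at $y$. Dominant energy condition: for every future-directed timelike $w^\mu$, the vector $-T^\mu{}_\nu w^\nu$ is zero or future-directed causal; in particular $T_{uu}\ge0$, $T_{vv}\ge0$, $T_{uv}\ge0$. *)

(* Defs.v *)
From HB Require Import structures.
From mathcomp Require Import all_boot all_order all_algebra.
From mathcomp Require Import all_classical all_reals all_analysis.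
Set Implicit Arguments.
Unset Strict Implicit.
Unset Printing Implicit Defensive.
Import Order.TTheory GRing.Theory Num.Theory.
Import numFieldNormedType.Exports.
Local Open Scope classical_set_scope.
Local Open Scope ring_scope.

(* Coordinates on R^d are row vectors; tangent vectors, in a chart, are column
   vectors of components. *)

Section Coordinates.
Variables (R : realType) (d : nat).
Implicit Types (f : 'rV[R]_d -> R) (z : 'rV[R]_d).

Definition partial (i : 'I_d) f : 'rV[R]_d -> R := fun z => 'D_('e_i) f z.

(* C^infinity on an open set U: every iterated partial derivative is Frechet
   differentiable at every point of U. *)
Definition smooth_on (U : set 'rV[R]_d) f : Prop :=
  forall (s : seq 'I_d) z, U z -> differentiable (foldr partial f s) z.

(* Generalized Kronecker delta, upper indices mu, lower indices nu. *)
Definition gdelta (s : nat) (mu nu : 'I_s -> 'I_d) : R :=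
  \det (\matrix_(i < s, j < s) (mu i == nu j)%:R).

Definition fcons (s : nat) (i : 'I_d) (mu : 'I_s -> 'I_d) : 'I_s.+1 -> 'I_d :=
  fun t => oapp mu i (unlift ord0 t).

Definition ev (m : nat) (q : 'I_m) : 'I_(m.*2) :=
  Ordinal (etrans (ltn_double q m) (ltn_ord q)).
Definition od (m : nat) (q : 'I_m) : 'I_(m.*2) :=
  Ordinal (etrans (ltn_Sdouble q m) (ltn_ord q)).

(* B i j k l stands for B_{ij}^{kl}. *)
Implicit Type B : 'I_d -> 'I_d -> 'I_d -> 'I_d -> R.

Definition pair_prod (m : nat) B (rho sigma : 'I_(m.*2) -> 'I_d) : R :=
  \prod_(q < m) B (rho (ev q)) (rho (od q)) (sigma (ev q)) (sigma (od q)).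

(* delta^{i_1..i_2m}_{j_1..j_2m} B_{i_1 i_2}^{j_1 j_2} ...; equal to 1 for
   m = 0. *)
Definition contract (m : nat) B : R :=
  \sum_(rho : {ffun 'I_(m.*2) -> 'I_d}) \sum_(sigma : {ffun 'I_(m.*2) -> 'I_d})
    gdelta rho sigma * pair_prod B rho sigma.

(* delta^{i i_1..i_2m}_{j j_1..j_2m} B_{i_1 i_2}^{j_1 j_2} ...; equal to
   delta^i_j for m = 0. *)
Definition contract2 (m : nat) B (i j : 'I_d) : R :=
  \sum_(rho : {ffun 'I_(m.*2) -> 'I_d}) \sum_(sigma : {ffun 'I_(m.*2) -> 'I_d})
    gdelta (fcons i rho) (fcons j sigma) * pair_prod B rho sigma.

Section Curvature.
Variable G : 'rV[R]_d -> 'M[R]_d.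

(* Gamma^k_{ij} *)
Definition christoffel (k i j : 'I_d) (z : 'rV[R]_d) : R :=
  2^-1 * \sum_l invmx (G z) k l *
    (partial i (fun w => G w l j) z + partial j (fun w => G w l i) z
     - partial l (fun w => G w i j) z).

(* R^k_{lij} = d_i Gamma^k_{jl} - d_j Gamma^k_{il} + ..., that is
   [D_i, D_j] V^k = R^k_{lij} V^l. *)
Definition riemann (k l i j : 'I_d) (z : 'rV[R]_d) : R :=
  partial i (christoffel k j l) z - partial j (christoffel k i l) z
  + \sum_p (christoffel k i p z * christoffel p j l z
            - christoffel k j p z * christoffel p i l z).

Definition ricci (i j : 'I_d) (z : 'rV[R]_d) : R := \sum_k riemann k i k j z.

(* R_{ij}^{kl} = g_{ip} R^p_{jqs} g^{qk} g^{sl} *)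
Definition riemann22 (z : 'rV[R]_d) (i j k l : 'I_d) : R :=
  \sum_p \sum_q \sum_s
    G z i p * riemann p j q s z * invmx (G z) q k * invmx (G z) s l.

(* C_{ij}^{kl} = R_{ij}^{kl} - kap * delta^{kl}_{ij} *)
Definition weyl22 (kap : R) (z : 'rV[R]_d) (i j k l : 'I_d) : R :=
  riemann22 z i j k l
  - kap * ((k == i)%:R * (l == j)%:R - (k == j)%:R * (l == i)%:R).

(* (D f)^2 *)
Definition grad_sq f (z : 'rV[R]_d) : R :=
  \sum_i \sum_j invmx (G z) i j * partial i f z * partial j f z.

(* The mixed Lovelock tensor; the order of the theory is [(d - 1) / 2]. *)
Definition lovelock (a : nat -> R) (Lam : R) (z : 'rV[R]_d) : 'M[R]_d :=
  \matrix_(mu, nu)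
    (- (\sum_(1 <= m < (d.-1)./2.+1)
          2 ^- m.+1 * (a m / m%:R) * contract2 m (riemann22 z) mu nu)
     + Lam * (mu == nu)%:R).

End Curvature.
End Coordinates.

(* Integral over R^n as an iterated Lebesgue integral (Tonelli); it is only
   used for nonnegative Borel functions. *)
Fixpoint iter_integral (R : realType) (n : nat) :
    ('rV[R]_n -> \bar R) -> \bar R :=
  match n with
  | 0%N => fun f => f 0
  | n'.+1 => fun f =>
      (\int[lebesgue_measure]_t
         iter_integral (fun x : 'rV[R]_n' => f (row_mx (t%:M : 'rV[R]_1) x)))%E
  end.

(* [cparam] is the inverse of [ccoord] on [ccoord @` cdom]; its values elsewhere
   are irrelevant. *)
Record chart (R : realType) (d : nat) (T : topologicalType) := Chart {
  cdom : set T;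
  ccoord : T -> 'rV[R]_d;
  cparam : 'rV[R]_d -> T;
  cdom_open : open cdom;
  cimg_open : open (ccoord @` cdom);
  ccoordK : forall y, cdom y -> cparam (ccoord y) = y;
  ccoord_cont : {within cdom, continuous ccoord};
  cparam_cont : {within ccoord @` cdom, continuous cparam} }.

Definition transition (R : realType) (d : nat) (T : topologicalType)
    (c1 c2 : chart R d T) : 'rV[R]_d -> 'rV[R]_d :=
  fun z => ccoord c2 (cparam c1 z).

Definition smooth_transition (R : realType) (d : nat) (T : topologicalType)
    (c1 c2 : chart R d T) : Prop :=
  forall i : 'I_d,
    smooth_on (ccoord c1 @` (cdom c1 `&` cdom c2))
              (fun z => transition c1 c2 z 0 i).

(* Nonempty, with its maximal atlas. *)
Record manifold (R : realType) (d : nat) := Manifold {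
  mpoint :> ptopologicalType;
  atlas : set (chart R d mpoint);
  mhausdorff : hausdorff_space mpoint;
  msecond_countable : @second_countable mpoint;
  atlas_cover : forall y, exists2 c, atlas c & cdom c y;
  atlas_smooth : forall c1 c2, atlas c1 -> atlas c2 -> smooth_transition c1 c2;
  atlas_max : forall c,
    (forall c', atlas c' -> smooth_transition c c' /\ smooth_transition c' c) ->
    atlas c }.

Section Tensors.
Variables (R : realType) (d : nat) (X : manifold R d).
Let chartX := chart R d X.

Definition smooth_fun (f : X -> R) : Prop :=
  forall c : chartX, atlas c ->
    smooth_on (ccoord c @` cdom c) (fun z => f (cparam c z)).

Definition orientation (O : set chartX) : Prop :=
  [/\ O `<=` @atlas R d X,
      forall y, exists2 c, O c & cdom c y &
      forall c1 c2 y, O c1 -> O c2 -> cdom c1 y -> cdom c2 y ->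
        0 < \det (jacobian (transition c1 c2) (ccoord c1 y))].

(* A tensor field is given by its components in each chart of the atlas,
   subject to the transformation law; [jacobian F z i j] is the derivative of
   the j-th component of F in the i-th coordinate. *)
Definition vector_field (v : chartX -> X -> 'cV[R]_d) : Prop :=
  forall c1 c2 y, atlas c1 -> atlas c2 -> cdom c1 y -> cdom c2 y ->
    v c2 y = (jacobian (transition c1 c2) (ccoord c1 y))^T *m v c1 y.

Definition sym_tensor2 (g : chartX -> X -> 'M[R]_d) : Prop :=
  (forall c1 c2 y, atlas c1 -> atlas c2 -> cdom c1 y -> cdom c2 y ->
     let J := jacobian (transition c1 c2) (ccoord c1 y) in
     g c1 y = J *m g c2 y *m J^T) /\
  (forall c y, atlas c -> cdom c y -> (g c y)^T = g c y).

Definition in_coord (g : chartX -> X -> 'M[R]_d) (c : chartX) :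
    'rV[R]_d -> 'M[R]_d := fun z => g c (cparam c z).

Definition smooth_tensor2 (g : chartX -> X -> 'M[R]_d) : Prop :=
  sym_tensor2 g /\
  forall c i j, atlas c ->
    smooth_on (ccoord c @` cdom c) (fun z => in_coord g c z i j).

Definition riemannian_metric (g : chartX -> X -> 'M[R]_d) : Prop :=
  smooth_tensor2 g /\
  forall c y, atlas c -> cdom c y ->
    forall w : 'cV[R]_d, w != 0 -> 0 < (w^T *m g c y *m w) 0 0.

Definition einstein_metric (kap : R) (g : chartX -> X -> 'M[R]_d) : Prop :=
  forall c y, atlas c -> cdom c y -> forall i j : 'I_d,
    ricci (in_coord g c) i j (ccoord c y)
      = (d%:R - 1) * kap * g c y i j.

(* The scalar W(m) and the tensor W(m)^i_j. *)
Definition Wscal (kap : R) (g : chartX -> X -> 'M[R]_d) (m : nat)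
    (c : chartX) (x : X) : R :=
  contract m (weyl22 (in_coord g c) kap (ccoord c x)).

Definition Wtens (kap : R) (g : chartX -> X -> 'M[R]_d) (m : nat)
    (c : chartX) (x : X) (i j : 'I_d) : R :=
  contract2 m (weyl22 (in_coord g c) kap (ccoord c x)) i j.

(* mu is the Riemannian volume measure of g on the Borel sets. *)
Definition riemannian_volume (g : chartX -> X -> 'M[R]_d)
    (mu : {measure set (g_sigma_algebraType (@open X)) -> \bar R}) : Prop :=
  forall c, atlas c ->
  forall A : set (g_sigma_algebraType (@open X)), measurable A ->
    A `<=` cdom c ->
    mu A = iter_integral (fun z =>
      (Num.sqrt (\det (in_coord g c z)) * \1_(ccoord c @` A) z)%:E).

End Tensors.

Section Causality.
Variables (R : realType) (d : nat).
Implicit Types (G : 'M[R]_d) (v w : 'cV[R]_d).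

Definition bil G v w : R := (v^T *m G *m w) 0 0.

Definition timelike G w : Prop := bil G w w < 0.
Definition causal G w : Prop := w != 0 /\ bil G w w <= 0.

(* For causal w; tau is a timelike vector fixing the time orientation. *)
Definition future_directed G (tau w : 'cV[R]_d) : Prop := bil G tau w < 0.

End Causality.

Section Surface.
Variables (R : realType) (X : manifold R 2).
Let chartX := chart R 2 X.

Definition lorentzian_metric (g : chartX -> X -> 'M[R]_2) : Prop :=
  smooth_tensor2 g /\
  forall c y, atlas c -> cdom c y ->
    exists2 P : 'M[R]_2, P \in unitmx &
      P^T *m g c y *m P = diag_mx (\row_j (if j == 0 then -1 else 1)).

Definition time_orientation (g : chartX -> X -> 'M[R]_2)
    (tau : chartX -> X -> 'cV[R]_2) : Prop :=
  [/\ vector_field tau,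
      forall c, atlas c -> {within cdom c, continuous (tau c)} &
      forall c y, atlas c -> cdom c y -> timelike (g c y) (tau c y)].

(* Coordinate 0 is u (ingoing), coordinate 1 is v (outgoing); the metric is
   - 2 e^{-f} du dv, and both coordinate vectors are future-directed. *)
Definition double_null (g : chartX -> X -> 'M[R]_2)
    (tau : chartX -> X -> 'cV[R]_2) (c : chartX) (f : 'rV[R]_2 -> R) : Prop :=
  forall y, cdom c y ->
    g c y = \matrix_(i, j) (if i == j then 0 else - expR (- f (ccoord c y))) /\
    forall i : 'I_2, future_directed (g c y) (tau c y) (delta_mx i 0).

(* theta_+ for i = 1 and theta_- for i = 0. *)
Definition expansion (n : nat) (r : X -> R) (c : chartX) (i : 'I_2) (y : X)
    : R :=
  n%:R * partial i (fun z => r (cparam c z)) (ccoord c y) / r y.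

Definition untrapped (n : nat) (r : X -> R) (c : chartX) (y : X) : Prop :=
  0 < expansion n r c 1 y /\ expansion n r c 0 y < 0.

(* The quasilocal mass as a function of the coordinates of the chart c; V is
   the volume of the compact factor and W m the constant value of W(m).  For 1 <= m <= (n + 1) / 2 the natural
   number subtractions n + 1 - 2m, n + 2 - 2m and m - 1 - l are exact. *)
Definition mass (n : nat) (a : nat -> R) (Lam kap V : R) (W : nat -> R)
    (g : chartX -> X -> 'M[R]_2) (r : X -> R) (c : chartX)
    (z : 'rV[R]_2) : R :=
  let rz := r (cparam c z) in
  let k := (n.+1)./2 in
  V * (\sum_(1 <= m < k.+1 | (m.*2 < n.+1)%N)
         a m / (2 ^+ m.+1 * m%:R)
         * (rz ^+ (n.+1 - m.*2) / (n.+1 - m.*2)%:R) * W m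
       - rz ^+ n.+1 / n.+1%:R * Lam
       + \sum_(1 <= m < k.+1) \sum_(0 <= l < m)
           a m * 2 ^- (m - l) * (rz ^+ (n.+1 - m.*2) / l.+1%:R)
           * 'C(m.-1, l)%:R
           * (\prod_(0 <= p < l.*2.+1) (n.+2 - m.*2 + p)%:R)
           * (kap - grad_sq (in_coord g c) (fun w => r (cparam c w)) z) ^+ l.+1
           * W (m.-1 - l)%N).

End Surface.

Section WarpedProduct.
Variables (R : realType) (n : nat) (X : manifold R 2) (K : manifold R n).

(* In the product chart given by c and c': the metric
   g_ab dy^a dy^b + r^2 gam_ij dx^i dx^j as a function of the coordinates. *)
Definition warped_metric (g : chart R 2 X -> X -> 'M[R]_2) (r : X -> R)
    (gam : chart R n K -> K -> 'M[R]_n)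
    (c : chart R 2 X) (c' : chart R n K) (z : 'rV[R]_(2 + n)) : 'M[R]_(2 + n) :=
  let y := cparam c (lsubmx z) in
  let x := cparam c' (rsubmx z) in
  block_mx (g c y) 0 0 (r y ^+ 2 *: gam c' x).

(* T_ab dy^a dy^b + r^2 p gam_ij dx^i dx^j *)
Definition warped_stress (T2 : chart R 2 X -> X -> 'M[R]_2) (r p : X -> R)
    (gam : chart R n K -> K -> 'M[R]_n)
    (c : chart R 2 X) (c' : chart R n K) (z : 'rV[R]_(2 + n)) : 'M[R]_(2 + n) :=
  let y := cparam c (lsubmx z) in
  let x := cparam c' (rsubmx z) in
  block_mx (T2 c y) 0 0 ((r y ^+ 2 * p y) *: gam c' x).

Definition product_coord (c : chart R 2 X) (c' : chart R n K) (y : X) (x : K)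
    : 'rV[R]_(2 + n) := row_mx (ccoord c y) (ccoord c' x).

Definition field_equations (a : nat -> R) (Lam : R)
    (g : chart R 2 X -> X -> 'M[R]_2) (r : X -> R)
    (gam : chart R n K -> K -> 'M[R]_n)
    (T2 : chart R 2 X -> X -> 'M[R]_2) (p : X -> R) : Prop :=
  forall c c' y x, atlas c -> atlas c' -> cdom c y -> cdom c' x ->
    let z := product_coord c c' y x in
    let G := warped_metric g r gam c c' in
    G z *m lovelock G a Lam z = warped_stress T2 r p gam c c' z.

Definition dominant_energy
    (g : chart R 2 X -> X -> 'M[R]_2) (tau : chart R 2 X -> X -> 'cV[R]_2)
    (r : X -> R) (gam : chart R n K -> K -> 'M[R]_n)
    (T2 : chart R 2 X -> X -> 'M[R]_2) (p : X -> R) : Prop :=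
  forall c c' y x, atlas c -> atlas c' -> cdom c y -> cdom c' x ->
    let z := product_coord c c' y x in
    let G := warped_metric g r gam c c' z in
    let T := warped_stress T2 r p gam c c' z in
    let t : 'cV[R]_(2 + n) := col_mx (tau c y) 0 in
    forall w : 'cV[R]_(2 + n), timelike G w -> future_directed G t w ->
      let j := - (invmx G *m T *m w) in
      j = 0 \/ (causal G j /\ future_directed G t j).

End WarpedProduct.

(* Main.v *)
Require Import Defs.
From mathcomp Require Import all_boot all_order all_algebra.
From mathcomp Require Import all_classical all_reals all_analysis.
From mathcomp Require Import perm ring lra zify.
Import Order.TTheory GRing.Theory Num.Theory.
Import numFieldNormedType.Exports.
Local Open Scope classical_set_scope.
Local Open Scope ring_scope.
Set Implicit Arguments.
Unset Strict Implicit.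
Unset Printing Implicit Defensive.

(* In double null coordinates the warped-product curvature has, up to symmetry,
   only the fibre part r^-2 (C + (kap - (Dr)^2) delta), the mixed part given by
   D_a D_b r, and the curvature of the base.  Since the base has two dimensions,
   the antisymmetry of the generalized Kronecker delta leaves in the base
   components of the Lovelock tensor no curvature factor of the base and at most
   one mixed factor, so that G_ab = - E g_ab + F (g_ab D^c D_c r - D_a D_b r) with
   E, F explicit polynomials in kap - (Dr)^2.  The mass is built so that its r- and
   (Dr)^2-derivatives are V r^n E and - V r^n F / 2, whence
   D_a M = V r^n (T_ab - g_ab T^c_c) D^b r.  On an untrapped surface the components
   of the right-hand side are, up to positive factors, the null components of the
   energy flux seen by the timelike vector (partial_v r, - partial_u r). *)

(** * Generalized Kronecker deltas *)

(** The binomials and products in the mass are Taylor coefficients: they come from expanding the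
    contraction of [C + x * delta2] in powers of [x]. Its derivative in [x] puts [delta2] into one
    slot, and tracing that slot out returns a multiple of the same contraction with one factor
    fewer. In the Lovelock tensor a mixed factor also uses up one slot and leaves a contraction of
    one order lower. So E and F are built from orders [m] and [m - 1] of one polynomial family, and
    this is why a single function of [r] and [kap - (Dr)^2] can have both as its derivatives. Both
    reductions are the same combinatorial operation, the removal of one marked slot ([slot_sum]).

    For odd [n] the top order [2m = n + 1] is degenerate: the power of [r] is constant, the first
    sum of the mass omits its term, and the contribution to E vanishes. It has to be checked
    separately wherever [r] is differentiated.

    The final identity is pointwise: everything is evaluated at one point of the base and one point
    of the fibre. *)

Section Kronecker.
Variables (R : realType) (d : nat).
Implicit Types (i j : 'I_d).

Lemma fcons0 s i (mu : 'I_s -> 'I_d) : fcons i mu ord0 = i.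
Proof. by rewrite /fcons unlift_none. Qed.

Lemma fconsS s i (mu : 'I_s -> 'I_d) t : fcons i mu (lift ord0 t) = mu t.
Proof. by rewrite /fcons liftK. Qed.

Lemma finfunK (aT : finType) (rT : Type) (F : aT -> rT) : finfun F = F :> (aT -> rT).
Proof. by apply/funext => x; rewrite ffunE. Qed.

Lemma gdelta_perm s (mu nu : 'I_s -> 'I_d) (p : 'S_s) :
  gdelta R (mu \o p) (nu \o p) = gdelta R mu nu.
Proof.
rewrite /gdelta; set M := (X in _ = \det X).
have -> : \matrix_(i, j) (((mu \o p) i == (nu \o p) j)%:R : R) =
    row_perm p (col_perm p M) by apply/matrixP => i j; rewrite !mxE.
rewrite row_permE col_permE !det_mulmx !det_perm odd_permV.
by rewrite mulrCA -signr_addb addbb mulr1.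
Qed.

Lemma gdelta_permr s (mu nu : 'I_s -> 'I_d) (p : 'S_s) :
  gdelta R mu (nu \o p) = (-1) ^+ p * gdelta R mu nu.
Proof.
rewrite /gdelta; set M := (X in _ = _ * \det X).
have -> : \matrix_(i, j) ((mu i == (nu \o p) j)%:R : R) = col_perm p M
  by apply/matrixP => i j; rewrite !mxE.
by rewrite col_permE det_mulmx det_perm odd_permV mulrC.
Qed.

Lemma gdeltaC s (mu nu : 'I_s -> 'I_d) : gdelta R mu nu = gdelta R nu mu.
Proof.
rewrite /gdelta -det_tr; congr (\det _).
by apply/matrixP => i j; rewrite !mxE eq_sym.
Qed.

Lemma gdelta_perml s (mu nu : 'I_s -> 'I_d) (p : 'S_s) :
  gdelta R (mu \o p) nu = (-1) ^+ p * gdelta R mu nu.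
Proof. by rewrite gdeltaC gdelta_permr gdeltaC. Qed.

Lemma gdelta_eq0l s (mu nu : 'I_s -> 'I_d) t t' :
  t != t' -> mu t = mu t' -> gdelta R mu nu = 0.
Proof.
move=> tt' e; apply: (determinant_alternate tt') => j.
by rewrite !mxE e.
Qed.

Lemma fcons_swap s i j (mu : 'I_s -> 'I_d) :
  fcons i (fcons j mu) = fcons j (fcons i mu) \o tperm ord0 (lift ord0 ord0).
Proof.
apply/funext => t /=; case: (unliftP ord0 t) => [t'|] ->; last first.
  by rewrite fcons0 tpermL fconsS fcons0.
case: (unliftP ord0 t') => [t''|] ->; last first.
  by rewrite tpermR fconsS !fcons0.
by rewrite tpermD ?fconsS // -(inj_eq val_inj).
Qed.

Lemma gdelta_swapr s i j (mu : 'I_s.+2 -> 'I_d) (nu : 'I_s -> 'I_d) :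
  gdelta R mu (fcons i (fcons j nu)) = - gdelta R mu (fcons j (fcons i nu)).
Proof. by rewrite fcons_swap gdelta_permr odd_tperm mulN1r. Qed.

(* Expanding along the row of [i], the sum over [i] turns each off-diagonal
   cofactor into the original determinant with one column moved to the front. *)
Lemma gdelta_trace s (mu nu : 'I_s -> 'I_d) :
  \sum_i gdelta R (fcons i mu) (fcons i nu) = (d%:R - s%:R) * gdelta R mu nu.
Proof.
rewrite {1}/gdelta.
under eq_bigr => i _ do rewrite (expand_det_row _ ord0) big_ord_recl.
rewrite big_split /= mulrBl; congr (_ + _).
  rewrite (eq_bigr (fun=> gdelta R mu nu)) => [|i _].
    by rewrite sumr_const card_ord mulr_natl.
  rewrite mxE !fcons0 eqxx mul1r /cofactor expr0 mul1r; congr (\det _).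
  by apply/matrixP => k l; rewrite !mxE !fconsS.
rewrite exchange_big /= (eq_bigr (fun=> - gdelta R mu nu)) => [|j _].
  by rewrite sumr_const card_ord mulNrn mulr_natl.
rewrite (bigD1 (nu j)) //= big1 ?addr0 => [|i ij]; last first.
  by rewrite mxE fcons0 fconsS (negPf ij) mul0r.
rewrite mxE fcons0 fconsS eqxx mul1r /cofactor.
case: s mu nu j => [|s] mu nu j; first by case: j.
set A := (X in \det X).
have -> : A = col_perm (lift_perm ord0 j 1)
    (\matrix_(k < s.+1, l < s.+1) (mu k == nu l)%:R).
  apply/matrixP => k l; rewrite !mxE fconsS; congr (_ == _)%:R.
  case: (unliftP ord0 l) => [l'|] ->; last first.
    rewrite lift_perm_id (_ : lift _ _ = ord0) ?fcons0 //.
    exact/val_inj.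
  rewrite lift_perm_lift perm1 (_ : lift (lift _ _) _ = lift ord0 (lift j l')).
    by rewrite fconsS.
  by apply/val_inj; rewrite /= /bump /= !add1n ltnS; case: (_ <= _)%N.
rewrite col_permE det_mulmx det_perm odd_permV odd_lift_perm odd_perm1 /= addbF.
rewrite mulrC -mulrA mulrC -[RHS]mulN1r; congr (_ * _).
by rewrite add0n signr_odd /bump /= add1n exprS mulrCA -expr2 sqrr_sign mulr1.
Qed.

Lemma sum_ffunS (S : nmodType) s (F : ('I_s.+1 -> 'I_d) -> S) :
  \sum_(rho : {ffun 'I_s.+1 -> 'I_d}) F rho =
  \sum_i \sum_(rho : {ffun 'I_s -> 'I_d}) F (fcons i rho).
Proof.
rewrite pair_big /=.
rewrite (reindex (fun p : 'I_d * {ffun 'I_s -> 'I_d} => finfun (fcons p.1 p.2))).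
  by apply: eq_bigr => p _; rewrite finfunK.
exists (fun rho : {ffun 'I_s.+1 -> 'I_d} =>
          (rho ord0, [ffun t : 'I_s => rho (lift ord0 t)])) => [[i rho]|rho] _.
  by congr (_, _); [rewrite ffunE fcons0|apply/ffunP => t; rewrite !ffunE fconsS].
apply/ffunP => t; rewrite ffunE /=.
by case: (unliftP ord0 t) => [t'|] ->; rewrite ?fcons0 ?fconsS ?ffunE.
Qed.

End Kronecker.

(** * Index pairs of a contraction and their permutations *)

Lemma ev_inj m : injective (@ev m).
Proof. by move=> p q [] /double_inj /val_inj. Qed.

Lemma od_inj m : injective (@od m).
Proof. by move=> p q [] /double_inj /val_inj. Qed.

Lemma ev_od m (p q : 'I_m) : (ev p == od q) = false.
Proof.
by apply/negP => /eqP [] /(congr1 odd); rewrite /= !odd_double.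
Qed.

Lemma ev_lift m (q : 'I_m) : ev (lift ord0 q) = lift ord0 (lift ord0 (ev q)).
Proof. exact/val_inj. Qed.

Lemma od_lift m (q : 'I_m) : od (lift ord0 q) = lift ord0 (lift ord0 (od q)).
Proof. exact/val_inj. Qed.

Lemma od_ord0 m : @od m.+1 ord0 = lift ord0 ord0.
Proof. exact/val_inj. Qed.

Lemma ev_ord0 m : @ev m.+1 ord0 = ord0.
Proof. exact/val_inj. Qed.

(** The codomain is arbitrary so that the factors may be real or polynomial; with real entries a
    product of slots is convertible to [pair_prod]. *)
Definition slot (S : Type) d m (A : 'I_d -> 'I_d -> 'I_d -> 'I_d -> S)
    (rho sigma : 'I_(m.*2) -> 'I_d) (q : 'I_m) : S :=
  A (rho (ev q)) (rho (od q)) (sigma (ev q)) (sigma (od q)).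

(** Pairs are exchanged as wholes, each member keeping its place in its pair, so that slots are
    permuted and not torn apart. *)
Definition slot_perm m (p q : 'I_m) : 'S_(m.*2) :=
  (tperm (ev p) (ev q) * tperm (od p) (od q))%g.

Lemma slot_perm_ev m (p q t : 'I_m) :
  slot_perm p q (ev t) = ev (tperm p q t).
Proof.
rewrite permM -(inj_tperm p q t (@ev_inj m)).
by rewrite (@tpermD _ (od p)) // eq_sym ev_od.
Qed.

Lemma slot_perm_od m (p q t : 'I_m) :
  slot_perm p q (od t) = od (tperm p q t).
Proof.
rewrite permM (@tpermD _ (ev p)) ?ev_od //.
by rewrite -(inj_tperm p q t (@od_inj m)).
Qed.

Section Slots.
Variables (S : comNzRingType) (d m : nat).
Variables (A B : 'I_d -> 'I_d -> 'I_d -> 'I_d -> S).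
Variable G : ('I_(m.+1.*2) -> 'I_d) -> ('I_(m.+1.*2) -> 'I_d) -> S.
Hypothesis G_perm : forall rho sigma (p : 'S_(m.+1.*2)),
  G (rho \o p) (sigma \o p) = G rho sigma.

Let term q (rho sigma : 'I_(m.+1.*2) -> 'I_d) :=
  G rho sigma * (slot A rho sigma q * \prod_(q' < m.+1 | q' != q) slot B rho sigma q').

(** Relabelling both summation variables by [slot_perm ord0 q] fixes [G] and carries the marked slot
    to the front. *)
Lemma slot_move q :
  \sum_(rho : {ffun 'I_(m.+1.*2) -> 'I_d}) \sum_(sigma : {ffun 'I_(m.+1.*2) -> 'I_d})
    term q rho sigma =
  \sum_(rho : {ffun 'I_(m.+1.*2) -> 'I_d}) \sum_(sigma : {ffun 'I_(m.+1.*2) -> 'I_d})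
    term ord0 rho sigma.
Proof.
pose p := slot_perm ord0 q.
pose P (rho : {ffun 'I_(m.+1.*2) -> 'I_d}) := [ffun t => rho (p t)].
have PK : cancel P (fun rho => [ffun t => rho (p^-1%g t)]).
  by move=> rho; apply/ffunP => t; rewrite !ffunE permKV.
have KP : cancel (fun rho : {ffun 'I_(m.+1.*2) -> 'I_d} => [ffun t => rho (p^-1%g t)]) P.
  by move=> rho; apply/ffunP => t; rewrite !ffunE permK.
have bP : bijective P by exists (fun rho : {ffun _ -> _} => [ffun t => rho (p^-1%g t)]).
rewrite (reindex P) /=; last exact: onW_bij.
apply: eq_bigr => rho _; rewrite (reindex P) /=; last exact: onW_bij.
apply: eq_bigr => sigma _; rewrite /term.
have -> : P rho = rho \o p :> (_ -> _) by apply/funext => t; rewrite ffunE.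
have -> : P sigma = sigma \o p :> (_ -> _) by apply/funext => t; rewrite ffunE.
have sl C t : slot C (rho \o p) (sigma \o p) t = slot C rho sigma (tperm ord0 q t).
  by rewrite /slot /= !slot_perm_ev !slot_perm_od.
rewrite G_perm sl tpermR; congr (_ * (_ * _)).
rewrite [RHS](reindex_inj (@perm_inj _ (tperm ord0 q))) /=.
apply: eq_big => [t|t _]; last by rewrite sl.
by rewrite -{2}(tpermR ord0 q) (inj_eq perm_inj).
Qed.

(** All positions of the marked slot contribute equally by [slot_move], whence the factor [m + 1];
    the four indices of the front slot are then summed separately. It serves for [A] the identity
    [delta2] in the pencil and for [A] the mixed curvature in the Lovelock tensor. *)
Lemma slot_sum :
  \sum_(rho : {ffun 'I_(m.+1.*2) -> 'I_d}) \sum_(sigma : {ffun 'I_(m.+1.*2) -> 'I_d})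
    G rho sigma * (\sum_q slot A rho sigma q * \prod_(q' < m.+1 | q' != q) slot B rho sigma q')
  = m.+1%:R * \sum_p0 \sum_p1 \sum_s0 \sum_s1 A p0 p1 s0 s1 *
     \sum_(rho : {ffun 'I_(m.*2) -> 'I_d}) \sum_(sigma : {ffun 'I_(m.*2) -> 'I_d})
        G (fcons p0 (fcons p1 rho)) (fcons s0 (fcons s1 sigma)) *
        \prod_(q < m) slot B rho sigma q.
Proof.
under eq_bigr => rho _ do under eq_bigr => sigma _ do rewrite mulr_sumr.
under eq_bigr => rho _ do rewrite exchange_big.
rewrite exchange_big /=.
rewrite (eq_bigr _ (fun q _ => slot_move q)) sumr_const card_ord mulr_natl; congr (_ *+ _).
rewrite (@sum_ffunS _ _ m.*2.+1 (fun rho =>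
  \sum_(sigma : {ffun 'I_(m.+1.*2) -> 'I_d}) term ord0 rho sigma)).
apply: eq_bigr => p0 _.
rewrite (@sum_ffunS _ _ m.*2 (fun rho =>
  \sum_(sigma : {ffun 'I_(m.+1.*2) -> 'I_d}) term ord0 (fcons p0 rho) sigma)).
apply: eq_bigr => p1 _.
transitivity (\sum_(rho : {ffun 'I_(m.*2) -> 'I_d}) \sum_s0 \sum_s1
  \sum_(sigma : {ffun 'I_(m.*2) -> 'I_d})
    term ord0 (fcons p0 (fcons p1 rho)) (fcons s0 (fcons s1 sigma))).
  apply: eq_bigr => rho _.
  rewrite (@sum_ffunS _ _ m.*2.+1); apply: eq_bigr => s0 _.
  by rewrite (@sum_ffunS _ _ m.*2 (fun sigma =>
    term ord0 (fcons p0 (fcons p1 rho)) (fcons s0 sigma))).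
rewrite exchange_big /=; apply: eq_bigr => s0 _.
rewrite exchange_big /=; apply: eq_bigr => s1 _.
rewrite mulr_sumr; apply: eq_bigr => rho _; rewrite mulr_sumr; apply: eq_bigr => sigma _.
rewrite /term mulrCA {1}/slot ev_ord0 od_ord0 !fconsS !fcons0; congr (_ * (_ * _)).
rewrite big_mkcond big_ord_recl /= mul1r; apply: eq_bigr => q _.
by rewrite /slot ev_lift od_lift !fconsS.
Qed.

End Slots.

(** * Contractions of a pencil C + x delta *)

Lemma deriv_prod_ord (S : comNzRingType) m (F : 'I_m -> {poly S}) :
  (\prod_q F q)^`() = \sum_q (F q)^`() * \prod_(q' | q' != q) F q'.
Proof.
elim: m F => [|m IHm] F; first by rewrite !big_ord0 derivC.
rewrite big_ord_recl derivM IHm [RHS]big_ord_recl; congr (_ + _).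
  by rewrite [X in _ = _ * X]big_mkcond big_ord_recl /= mul1r.
rewrite mulr_sumr; apply: eq_bigr => q _.
rewrite [X in _ = _ * X]big_mkcond big_ord_recl /= -big_mkcond /= mulrCA.
by congr (_ * (_ * _)); apply: eq_bigl => t; rewrite (inj_eq lift_inj).
Qed.

Lemma sum4_exchange (S : pzRingType) (I J : finType) (f : I -> I -> I -> I -> S)
    (g : I -> I -> I -> I -> J -> S) :
  \sum_a \sum_b \sum_c \sum_e f a b c e * \sum_j g a b c e j =
  \sum_j \sum_a \sum_b \sum_c \sum_e f a b c e * g a b c e j.
Proof.
rewrite [RHS]exchange_big; apply: eq_bigr => a _.
rewrite [RHS]exchange_big; apply: eq_bigr => b _.
rewrite [RHS]exchange_big; apply: eq_bigr => c _.
rewrite [RHS]exchange_big; apply: eq_bigr => e _.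
by rewrite mulr_sumr.
Qed.

Section DeltaContraction.
Variables (R : realType) (d : nat).
Implicit Type C : 'I_d -> 'I_d -> 'I_d -> 'I_d -> R.

Definition delta2 (i j k l : 'I_d) : R :=
  (k == i)%:R * (l == j)%:R - (k == j)%:R * (l == i)%:R.

Lemma sum_pick (V : pzRingType) (F : 'I_d -> V) i :
  \sum_j (j == i)%:R * F j = F i.
Proof.
rewrite (bigD1 i) //= eqxx mul1r big1 ?addr0 // => j /negPf ->.
by rewrite mul0r.
Qed.

(** By antisymmetry the two terms of [delta2] contribute equally, which gives the 2. The two
    remaining traces are over deltas of orders [s + 2] and [s + 1], hence the factors [d - (s + 1)]
    and [d - s]. *)
Lemma delta2_gdelta s (rho sigma : 'I_s -> 'I_d) :
  \sum_p0 \sum_p1 \sum_s0 \sum_s1 delta2 p0 p1 s0 s1 *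
     gdelta R (fcons p0 (fcons p1 rho)) (fcons s0 (fcons s1 sigma)) =
  2 * ((d%:R - s.+1%:R) * (d%:R - s%:R)) * gdelta R rho sigma.
Proof.
transitivity (\sum_p0 \sum_p1 2 *
    gdelta R (fcons p0 (fcons p1 rho)) (fcons p0 (fcons p1 sigma))).
  apply: eq_bigr => p0 _; apply: eq_bigr => p1 _; rewrite /delta2.
  under eq_bigr => s0 _ do under eq_bigr => s1 _ do rewrite mulrBl -!mulrA.
  under eq_bigr => s0 _ do rewrite sumrB -!mulr_sumr !sum_pick.
  by rewrite sumrB !sum_pick (gdelta_swapr R p1 p0) opprK -mulr2n mulr_natl.
rewrite exchange_big /=.
under eq_bigr => p1 _ do rewrite -mulr_sumr gdelta_trace.
by rewrite -mulr_sumr -mulr_sumr gdelta_trace; ring.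
Qed.

(* [(pencil m C).[x]] is the contraction of [C + x * delta2]; differentiating in
   [x] replaces one factor by [delta2], which can be traced out. *)
Definition pencil m C : {poly R} :=
  \sum_(rho : {ffun 'I_(m.*2) -> 'I_d}) \sum_(sigma : {ffun 'I_(m.*2) -> 'I_d})
    (gdelta R rho sigma)%:P *
    \prod_(q < m) slot (fun i j k l => (C i j k l)%:P + (delta2 i j k l)%:P * 'X)
                    rho sigma q.

Lemma pencil_horner m C x :
  (pencil m C).[x] =
  Defs.contract m (fun i j k l => C i j k l + x * delta2 i j k l).
Proof.
rewrite /pencil !(horner_sum, hornerE).
apply: eq_bigr => rho _; rewrite horner_sum; apply: eq_bigr => sigma _.
rewrite hornerM hornerC horner_prod; congr (_ * _); apply: eq_bigr => q _.
by rewrite /slot !hornerE mulrC.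
Qed.

Lemma pencil_coef0 m C : (pencil m C)`_0 = Defs.contract m C.
Proof.
rewrite -horner_coef0 pencil_horner.
apply: eq_bigr => rho _; apply: eq_bigr => sigma _; congr (_ * _).
by apply: eq_bigr => q _; rewrite mul0r addr0.
Qed.

Lemma pencil_deriv m C :
  (pencil m.+1 C)^`() =
  (m.+1%:R * (2 * ((d%:R - m.*2.+1%:R) * (d%:R - m.*2%:R)))) *: pencil m C.
Proof.
rewrite /pencil raddf_sum /=.
transitivity (\sum_(rho : {ffun 'I_(m.+1.*2) -> 'I_d})
    \sum_(sigma : {ffun 'I_(m.+1.*2) -> 'I_d}) (gdelta R rho sigma)%:P *
    \sum_q slot (fun i j k l => (delta2 i j k l)%:P) rho sigma q *
     \prod_(q' < m.+1 | q' != q)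
       slot (fun i j k l => (C i j k l)%:P + (delta2 i j k l)%:P * 'X) rho sigma q').
  apply: eq_bigr => rho _; rewrite raddf_sum; apply: eq_bigr => sigma _ /=.
  rewrite deriv_mulC deriv_prod_ord; congr (_ * _); apply: eq_bigr => q _.
  by rewrite {1}/slot derivD derivC add0r deriv_mulC derivX mulr1.
rewrite (slot_sum _ _ (G := fun rho sigma => (gdelta R rho sigma)%:P)); last first.
  by move=> rho sigma p; rewrite gdelta_perm.
rewrite -scalerA scaler_nat mulr_natl; congr (_ *+ _).
rewrite sum4_exchange scaler_sumr; apply: eq_bigr => rho _.
rewrite sum4_exchange scaler_sumr; apply: eq_bigr => sigma _.
rewrite -mul_polyC [RHS]mulrA -polyCM -delta2_gdelta.
do 4 (rewrite raddf_sum /= mulr_suml; apply: eq_bigr => ? _).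
by rewrite polyCM mulrA.
Qed.

(** The binomial counts the choices of [j] slots for [delta2]; each of them, traced out, gives a 2
    and one factor [d - q] for each of the two index positions it removes. *)
Definition pencil_coef m j : R :=
  'C(m, j)%:R * 2 ^+ j * \prod_((m - j).*2 <= q < m.*2) (d%:R - q%:R).

(** Coefficient [j + 1] is read off the derivative, which [pencil_deriv] expresses by the pencil of
    order one lower; dividing by [j + 1] is possible in characteristic 0. *)
Lemma pencil_coefE m C j :
  (pencil m C)`_j = pencil_coef m j * Defs.contract (m - j) C.
Proof.
elim: m j => [|m IHm] j.
  case: j => [|j].
    by rewrite pencil_coef0 /pencil_coef big_geq // bin0 expr0 !mulr1 mul1r.
  rewrite /pencil_coef bin0n mul0r mul0r mul0r /pencil nth_default //.
  rewrite (leq_trans (size_sum _ _ _)) //; apply/bigmax_leqP => rho _.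
  rewrite (leq_trans (size_sum _ _ _)) //; apply/bigmax_leqP => sigma _.
  by rewrite big_ord0 mulr1 (leq_trans (size_polyC_leq1 _)).
case: j => [|j].
  by rewrite pencil_coef0 /pencil_coef subn0 big_geq // bin0 expr0 !mulr1 mul1r.
have j0 : j.+1%:R != 0 :> R by rewrite pnatr_eq0.
apply: (mulIf j0); rewrite mulr_natr -coef_deriv pencil_deriv coefZ IHm.
rewrite [LHS]mulrA [RHS]mulrAC subSS; congr (_ * _); rewrite /pencil_coef subSS.
have [mj|jm] := ltnP m j; first by rewrite !bin_small // !(mul0r, mulr0).
rewrite doubleS !big_nat_recr ?leqW ?leq_double ?leq_subr //=.
(* The absorption identity [(m + 1) 'C(m, j) = (j + 1) 'C(m + 1, j + 1)] matches the binomials. *)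
have := mul_bin_diag m.+1 j; rewrite /= => /(congr1 (fun k => k%:R : R)).
rewrite !natrM exprS => e.
transitivity (m.+1%:R * 'C(m, j)%:R *
    (2 * 2 ^+ j * \prod_((m - j).*2 <= i < m.*2) (d%:R - i%:R) *
     (d%:R - m.*2%:R) * (d%:R - (m.*2).+1%:R)) : R); first by ring.
by rewrite e; ring.
Qed.

Lemma contract_pencil m C x :
  Defs.contract m (fun i j k l => C i j k l + x * delta2 i j k l) =
  \sum_(j < m.+1) pencil_coef m j * Defs.contract (m - j) C * x ^+ j.
Proof.
rewrite -pencil_horner (@horner_coef_wide _ m.+1); last first.
  apply/leq_sizeP => j mj.
  by rewrite pencil_coefE /pencil_coef bin_small // !mul0r.
by apply: eq_bigr => j _; rewrite pencil_coefE.
Qed.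

Lemma contract_scale m C x :
  Defs.contract m (fun i j k l => x * C i j k l) = x ^+ m * Defs.contract m C.
Proof.
rewrite /Defs.contract mulr_sumr; apply: eq_bigr => rho _.
rewrite mulr_sumr; apply: eq_bigr => sigma _.
by rewrite /pair_prod big_split /= prodr_const card_ord mulrCA.
Qed.

(** By pigeonhole an upper index repeats, and the delta has two equal rows. *)
Lemma contract_overflow m C : (d < m.*2)%N -> Defs.contract m C = 0.
Proof.
move=> dm; rewrite /Defs.contract big1 // => rho _; rewrite big1 // => sigma _.
suff [t [t' [tt' e]]] : exists t t', t != t' /\ rho t = rho t'.
  by rewrite (gdelta_eq0l R _ tt' e) mul0r.
have /injectivePn[t [t' tt' e]] : ~~ injectiveb rho.
  apply/negP => /injectiveP /leq_card; rewrite !card_ord.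
  by rewrite leqNgt dm.
by exists t, t'.
Qed.

End DeltaContraction.

(** * Contractions on a product with two-dimensional base *)

Section ProductContraction.
Variables (R : realType) (n : nat).
Notation D := 'I_(2 + n).
Notation l := (@lshift 2 n).
Notation r := (@rshift 2 n).
Implicit Types (a b c e : 'I_2) (i j : 'I_n).

Definition base (x : D) : bool := (x < 2)%N.

Lemma base_l a : base (l a).
Proof. by rewrite /base /=. Qed.

Lemma base_r i : base (r i) = false.
Proof. by rewrite /base /= ltnNge leq_addr. Qed.

Lemma lshift_rshift a i : (l a == r i) = false.
Proof. by apply/negP => /eqP/(congr1 base); rewrite base_l base_r. Qed.

Lemma fcons_rshift s i (mu : 'I_s -> 'I_n) :
  fcons (r i) (r \o mu) = r \o fcons i mu.
Proof.
apply/funext => t.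
by case: (unliftP ord0 t) => [t'|] -> /=; rewrite ?fconsS ?fcons0 //= fconsS.
Qed.

Lemma gdelta_block1 s a b (mu nu : 'I_s -> 'I_n) :
  gdelta R (fcons (l a) (r \o mu)) (fcons (l b) (r \o nu)) =
  (a == b)%:R * gdelta R mu nu.
Proof.
rewrite /gdelta (expand_det_row _ ord0) big_ord_recl big1 ?addr0 => [|t _].
  rewrite mxE !fcons0 (inj_eq (@lshift_inj _ _)) /cofactor expr0 mul1r.
  congr (_ * \det _); apply/matrixP => t t'.
  by rewrite !mxE !fconsS /= (inj_eq (@rshift_inj _ _)).
by rewrite mxE fcons0 fconsS lshift_rshift mul0r.
Qed.

(** A base index never equals a fibre index, so the first row meets only the first two columns; both
    minors are instances of [gdelta_block1], the second with a sign. *)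
Lemma gdelta_block2 s a b c e (mu nu : 'I_s -> 'I_n) :
  gdelta R (fcons (l a) (fcons (l c) (r \o mu)))
           (fcons (l b) (fcons (l e) (r \o nu))) =
  ((a == b)%:R * (c == e)%:R - (a == e)%:R * (c == b)%:R) * gdelta R mu nu.
Proof.
rewrite {1}/gdelta (expand_det_row _ ord0) !big_ord_recl big1 ?addr0 => [|t _].
  rewrite !mxE !fcons0 !fconsS fcons0 !(inj_eq (@lshift_inj _ _)).
  rewrite mulrBl -!mulrA -!gdelta_block1 /cofactor expr0 mul1r /= expr1 mulN1r mulrN.
  congr (_ * _ - _ * _); congr (\det _); apply/matrixP => t t'.
    by rewrite !mxE !fconsS.
  rewrite !mxE !fconsS; congr (_ == _)%:R.
  case: (unliftP ord0 t') => [t''|] ->; last first.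
    by rewrite fcons0 (_ : lift _ _ = ord0) ?fcons0 //; exact/val_inj.
  by rewrite fconsS (_ : lift _ _ = lift ord0 (lift ord0 t'')) ?fconsS //; exact/val_inj.
by rewrite mxE fcons0 !fconsS /= lshift_rshift mul0r.
Qed.

Lemma sum_rshift s (F : ('I_s -> D) -> R) :
  (forall rho : 'I_s -> D, (exists t, base (rho t)) -> F rho = 0) ->
  \sum_(rho : {ffun 'I_s -> D}) F rho =
  \sum_(rho : {ffun 'I_s -> 'I_n}) F (r \o rho).
Proof.
elim: s F => [|s IHs] F F0.
  pose f0 k : {ffun 'I_0 -> 'I_k} := ffun0 (card_ord 0).
  rewrite (bigD1 (f0 _)) //= big1 => [|rho]; last first.
    by rewrite (_ : rho = f0 _) ?eqxx //; apply/ffunP => -[].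
  rewrite [RHS](bigD1 (f0 _)) //= [in RHS]big1 => [|rho]; last first.
    by rewrite (_ : rho = f0 _) ?eqxx //; apply/ffunP => -[].
  by congr (F _ + _); apply/funext => -[].
rewrite sum_ffunS big_split_ord /= big1 ?add0r => [|a _]; last first.
  rewrite big1 // => rho _; apply: F0; exists ord0.
  by rewrite fcons0 base_l.
rewrite (sum_ffunS (fun rho => F (r \o rho))); apply: eq_bigr => i _.
rewrite (IHs (fun rho => F (fcons (r i) rho))) => [|rho [t bt]].
  by apply: eq_bigr => rho _; rewrite fcons_rshift.
by apply: F0; exists (lift ord0 t); rewrite fconsS.
Qed.

Variable B : D -> D -> D -> D -> R.

Definition fibre_part x y z w :=
  if [|| base x, base y, base z | base w] then 0 else B x y z w.

Definition mixed_part x y z w :=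
  if (base x (+) base y) && (base z (+) base w) then B x y z w else 0.

Definition fibre i j i' j' := B (r i) (r j) (r i') (r j').

(** Pairs of two base indices, where the curvature of the base would enter, are left unconstrained:
    [gdelta_base_uniq] removes them. *)
Hypothesis B_balanced : forall x y z w,
  ~~ (base x && base y) -> ~~ (base z && base w) ->
  base x || base y != base z || base w -> B x y z w = 0.

Lemma slot_fibre_base m (rho sigma : 'I_(m.*2) -> D) t :
  base (rho t) || base (sigma t) ->
  \prod_(q < m) slot fibre_part rho sigma q = 0.
Proof.
move=> bt.
have [q tq] : exists q : 'I_m, t = ev q \/ t = od q.
  have tm : (t./2 < m)%N by rewrite ltn_half_double.
  exists (Ordinal tm); rewrite -[t]/(t : 'I_ _).
  case: (boolP (odd t)) => ot; [right|left]; apply/val_inj => /=;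
  by rewrite -[LHS]odd_double_half ?ot ?(negPf ot).
rewrite (bigD1 q) //= (_ : slot _ _ _ q = 0) ?mul0r // /slot /fibre_part.
by case: tq bt => -> /orP[] ->; rewrite ?orbT.
Qed.

(** Each list has room for one base index only. By balance the base indices of [rho] and [sigma]
    must share a slot, which is then mixed, and all other slots are purely fibre; so the expansion
    stops at one mixed factor. *)
Lemma slot_prod_split m (rho sigma : 'I_(m.*2) -> D) :
  (forall t t', base (rho t) -> base (rho t') -> t = t') ->
  (forall t t', base (sigma t) -> base (sigma t') -> t = t') ->
  \prod_q slot B rho sigma q = \prod_q slot fibre_part rho sigma q +
   \sum_q slot mixed_part rho sigma q *
     \prod_(q' < m | q' != q) slot fibre_part rho sigma q'.
Proof.
elim: m rho sigma => [|m IHm] rho sigma hr hs; first by rewrite !big_ord0 addr0.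
rewrite !big_ord_recl.
pose rho' := rho \o lift ord0 \o lift ord0 : 'I_(m.*2) -> D.
pose sigma' := sigma \o lift ord0 \o lift ord0 : 'I_(m.*2) -> D.
have S C q : slot C rho sigma (lift ord0 q) = slot C rho' sigma' q.
  by rewrite /slot ev_lift od_lift.
have SP C : \prod_(q < m) slot C rho sigma (lift ord0 q) = \prod_q slot C rho' sigma' q.
  by apply: eq_bigr => q _; rewrite S.
have P0 : \prod_(q' < m.+1 | q' != ord0) slot fibre_part rho sigma q' =
    \prod_q slot fibre_part rho' sigma' q.
  by rewrite big_mkcond big_ord_recl /= mul1r -SP.
have PS q : \prod_(q' < m.+1 | q' != lift ord0 q) slot fibre_part rho sigma q' =
    slot fibre_part rho sigma ord0 *
    \prod_(q' < m | q' != q) slot fibre_part rho' sigma' q'.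
  rewrite big_mkcond big_ord_recl /= [in RHS]big_mkcond; congr (_ * _).
  by apply: eq_bigr => q' _; rewrite (inj_eq lift_inj) S.
rewrite !SP P0 {}IHm; first last.
- by move=> t t' h h'; apply: (@lift_inj _ ord0); apply: (@lift_inj _ ord0); apply: hs.
- by move=> t t' h h'; apply: (@lift_inj _ ord0); apply: (@lift_inj _ ord0); apply: hr.
rewrite [X in _ = _ + (_ + X)](_ : _ = slot fibre_part rho sigma ord0 *
   \sum_q slot mixed_part rho' sigma' q *
     \prod_(q' < m | q' != q) slot fibre_part rho' sigma' q'); last first.
  by rewrite mulr_sumr; apply: eq_bigr => q _; rewrite S PS mulrCA.
set P := \prod_q _; set Q := \sum_q _.
have eo : ev (ord0 : 'I_m.+1) != od ord0 by rewrite ev_od.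
have nr : ~~ (base (rho (ev ord0)) && base (rho (od ord0))).
  by apply/negP => /andP[h h']; move: eo; rewrite (hr _ _ h h') eqxx.
have ns : ~~ (base (sigma (ev ord0)) && base (sigma (od ord0))).
  by apply/negP => /andP[h h']; move: eo; rewrite (hs _ _ h h') eqxx.
have [e|ne] := eqVneq (base (rho (ev ord0)) || base (rho (od ord0)))
                      (base (sigma (ev ord0)) || base (sigma (od ord0))); last first.
  (* An unbalanced first slot annihilates every product on both sides. *)
  have BB := B_balanced nr ns ne.
  rewrite /slot BB /fibre_part /mixed_part BB !if_same.
  by rewrite !mul0r !addr0.
have [b|nb] := boolP (base (rho (ev ord0)) || base (rho (od ord0))).
  have -> : slot fibre_part rho sigma ord0 = 0.
    by rewrite /slot /fibre_part orbA b.
  have -> : slot mixed_part rho sigma ord0 = slot B rho sigma ord0.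
    rewrite /slot /mixed_part; move: nr ns e b.
    by do 4 case: (base _).
  (* The first slot has used up the only base index of [rho], so no later slot can be mixed. *)
  suff -> : Q = 0 by rewrite addr0 !mul0r add0r addr0.
  rewrite /Q big1 // => q _; rewrite /slot /mixed_part.
  suff [-> ->] : base (rho' (ev q)) = false /\ base (rho' (od q)) = false.
    by rewrite mul0r.
  have bn (t : 'I_(m.*2)) : base (rho' t) = false.
    apply/negP => h; case/orP: b => h'.
      by have := hr _ _ h h'; rewrite ev_ord0 => /(congr1 val).
    by have := hr _ _ h h'; rewrite od_ord0 => /(congr1 val).
  by rewrite !bn.
have -> : slot mixed_part rho sigma ord0 = 0.
  by rewrite /slot /mixed_part; move: nb; do 2 case: (base (rho _)).
have -> : slot fibre_part rho sigma ord0 = slot B rho sigma ord0.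
  by rewrite /slot /fibre_part orbA (negPf nb) -e (negPf nb).
by rewrite mul0r add0r mulrDr.
Qed.

Lemma fcons_lift_perm s (i : D) (rho : 'I_s -> D) (p : 'S_s) :
  fcons i (rho \o p) = fcons i rho \o lift_perm ord0 ord0 p.
Proof.
apply/funext => t /=; case: (unliftP ord0 t) => [t'|] ->.
  by rewrite fconsS lift_perm_lift fconsS.
by rewrite lift_perm_id !fcons0.
Qed.

(* Three base indices among only two values cannot be distinct. *)
Lemma gdelta_base_uniq s a (mu : 'I_s -> D) (nu : 'I_s.+1 -> D) t t' :
  base (mu t) -> base (mu t') -> t != t' ->
  gdelta R (fcons (l a) mu) nu = 0.
Proof.
have Bl x : base x -> exists b, x = l b.
  by move=> bx; exists (Ordinal bx); exact/val_inj.
move=> /Bl[b tb] /Bl[c tc] tt'.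
have [bc|bc] := eqVneq b c.
  apply: (@gdelta_eq0l R _ _ _ _ (lift ord0 t) (lift ord0 t')).
    by rewrite (inj_eq lift_inj).
  by rewrite !fconsS tb tc bc.
have [ab|ac] : a = b \/ a = c.
  move: a b c bc {tb tc} => [[|[|//]] ?] [[|[|//]] ?] [[|[|//]] ?] bc;
  by [left; exact/val_inj|right; exact/val_inj|case/eqP: bc; exact/val_inj].
- apply: (@gdelta_eq0l R _ _ _ _ ord0 (lift ord0 t)) => //.
  by rewrite fcons0 fconsS tb ab.
apply: (@gdelta_eq0l R _ _ _ _ ord0 (lift ord0 t')) => //.
by rewrite fcons0 fconsS tc ac.
Qed.


Variable X : 'I_2 -> 'I_2 -> R.
Hypothesis B_lrlr : forall c i e j, B (l c) (r i) (l e) (r j) = X c e * (i == j)%:R.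
Hypothesis B_rllr : forall c i e j, B (r i) (l c) (l e) (r j) = - (X c e * (i == j)%:R).
Hypothesis B_lrrl : forall c i e j, B (l c) (r i) (r j) (l e) = - (X c e * (i == j)%:R).
Hypothesis B_rlrl : forall c i e j, B (r i) (l c) (r j) (l e) = X c e * (i == j)%:R.

Lemma sum2_split (f : D -> D -> R) :
  (forall c e, f (l c) (l e) = 0) -> (forall i j, f (r i) (r j) = 0) ->
  \sum_x \sum_y f x y = \sum_c \sum_i (f (l c) (r i) + f (r i) (l c)).
Proof.
move=> fl fr; rewrite big_split_ord /=.
transitivity (\sum_c \sum_i f (l c) (r i) + \sum_c \sum_i f (r i) (l c)).
  congr (_ + _).
    by apply: eq_bigr => c _; rewrite big_split_ord /= big1 ?add0r.
  rewrite [RHS]exchange_big /=; apply: eq_bigr => i _.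
  by rewrite big_split_ord /= [X in _ + X]big1 ?addr0.
by rewrite -big_split /=; apply: eq_bigr => c _; rewrite big_split.
Qed.

Lemma sum_diag (f : 'I_n -> R) c e i :
  \sum_j X c e * (i == j)%:R * f j = X c e * f i.
Proof.
rewrite (bigD1 i) //= eqxx mulr1 big1 ?addr0 // => j ji.
by rewrite eq_sym (negPf ji) mulr0 mul0r.
Qed.

(** The 4 counts the orders of base and fibre index in the lower and in the upper pair: each swap
    changes the sign of [B] and of [g] together, so all four terms agree. *)
Lemma contract_mixed (g : D -> D -> D -> D -> R) :
  (forall x y z w, g y x z w = - g x y z w) ->
  (forall x y z w, g x y w z = - g x y z w) ->
  \sum_x \sum_y \sum_z \sum_w mixed_part x y z w * g x y z w =
  4 * \sum_c \sum_e X c e * \sum_i g (l c) (r i) (l e) (r i).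
Proof.
move=> gl gr.
rewrite sum2_split => [|c e|i j]; first last.
- by rewrite big1 // => z _; rewrite big1 // => w _; rewrite /mixed_part !base_r mul0r.
- by rewrite big1 // => z _; rewrite big1 // => w _; rewrite /mixed_part !base_l mul0r.
rewrite mulr_sumr; apply: eq_bigr => c _.
have -> : \sum_e X c e * (\sum_i g (l c) (r i) (l e) (r i)) =
    \sum_i \sum_e X c e * g (l c) (r i) (l e) (r i).
  by rewrite exchange_big; apply: eq_bigr => e _; rewrite mulr_sumr.
rewrite mulr_sumr; apply: eq_bigr => i _.
rewrite !sum2_split; first last.
- by move=> ? ?; rewrite /mixed_part !base_l !base_r mul0r.
- by move=> ? ?; rewrite /mixed_part !base_l !base_r mul0r.
- by move=> ? ?; rewrite /mixed_part !base_l !base_r mul0r.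
- by move=> ? ?; rewrite /mixed_part !base_l !base_r mul0r.
rewrite -big_split mulr_sumr /=; apply: eq_bigr => e _.
rewrite /mixed_part !base_l !base_r /= -big_split /=.
transitivity (\sum_j X c e * (i == j)%:R * (4 * g (l c) (r i) (l e) (r j))).
  apply: eq_bigr => j _.
  rewrite B_lrlr B_rllr B_lrrl B_rlrl (gl (l c) (r i) (r j)) !(gr _ _ (l e) (r j)).
  by rewrite (gl (l c) (r i)); ring.
by rewrite sum_diag; ring.
Qed.

Lemma contract2_fibre m a b :
  \sum_(rho : {ffun 'I_(m.*2) -> D}) \sum_(sigma : {ffun 'I_(m.*2) -> D})
    gdelta R (fcons (l a) rho) (fcons (l b) sigma) *
    \prod_q slot fibre_part rho sigma q =
  (a == b)%:R * Defs.contract m fibre.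
Proof.
rewrite (sum_rshift (F := fun rho => \sum_(sigma : {ffun 'I_(m.*2) -> D})
    gdelta R (fcons (l a) rho) (fcons (l b) sigma) *
    \prod_q slot fibre_part rho sigma q)) => [|rho [t bt]]; last first.
  by rewrite big1 // => sigma _; rewrite (@slot_fibre_base _ _ _ t) ?bt ?mulr0.
rewrite /Defs.contract mulr_sumr; apply: eq_bigr => rho _.
rewrite (sum_rshift (F := fun sigma =>
    gdelta R (fcons (l a) (r \o rho)) (fcons (l b) sigma) *
    \prod_q slot fibre_part (r \o rho) sigma q)) => [|sigma [t bt]]; last first.
  by rewrite (@slot_fibre_base _ _ _ t) ?bt ?orbT ?mulr0.
rewrite mulr_sumr; apply: eq_bigr => sigma _.
by rewrite gdelta_block1 -mulrA; congr (_ * (_ * _)); apply: eq_bigr.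
Qed.

(** The base indices split off by [gdelta_block2]; the trace over the remaining free fibre index
    gives [n - 2m]. *)
Lemma contract4_fibre m a b c e :
  \sum_i \sum_(rho : {ffun 'I_(m.*2) -> D}) \sum_(sigma : {ffun 'I_(m.*2) -> D})
    gdelta R (fcons (l a) (fcons (l c) (fcons (r i) rho)))
             (fcons (l b) (fcons (l e) (fcons (r i) sigma))) *
    \prod_q slot fibre_part rho sigma q =
  ((a == b)%:R * (c == e)%:R - (a == e)%:R * (c == b)%:R) *
  ((n%:R - m.*2%:R) * Defs.contract m fibre).
Proof.
transitivity (\sum_i \sum_(rho : {ffun 'I_(m.*2) -> 'I_n})
   \sum_(sigma : {ffun 'I_(m.*2) -> 'I_n})
   ((a == b)%:R * (c == e)%:R - (a == e)%:R * (c == b)%:R) *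
   gdelta R (fcons i rho) (fcons i sigma) * \prod_q slot fibre rho sigma q).
  apply: eq_bigr => i _.
  rewrite (sum_rshift (F := fun rho => \sum_(sigma : {ffun 'I_(m.*2) -> D})
      gdelta R (fcons (l a) (fcons (l c) (fcons (r i) rho)))
             (fcons (l b) (fcons (l e) (fcons (r i) sigma))) *
      \prod_q slot fibre_part rho sigma q)) => [|rho [t bt]]; last first.
    by rewrite big1 // => sigma _; rewrite (@slot_fibre_base _ _ _ t) ?bt ?mulr0.
  apply: eq_bigr => rho _.
  rewrite (sum_rshift (F := fun sigma =>
      gdelta R (fcons (l a) (fcons (l c) (fcons (r i) (r \o rho))))
             (fcons (l b) (fcons (l e) (fcons (r i) sigma))) *
      \prod_q slot fibre_part (r \o rho) sigma q)) => [|sigma [t bt]]; last first.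
    by rewrite (@slot_fibre_base _ _ _ t) ?bt ?orbT ?mulr0.
  apply: eq_bigr => sigma _.
  by rewrite !fcons_rshift gdelta_block2; congr (_ * _); apply: eq_bigr.
rewrite exchange_big /Defs.contract !mulr_sumr; apply: eq_bigr => rho _.
rewrite exchange_big !mulr_sumr; apply: eq_bigr => sigma _ /=.
by rewrite -mulr_suml -mulr_sumr gdelta_trace !mulrA.
Qed.

(* [delta^{ac}_{be} X_c^e] is the only trace of the mixed curvature left in the
   base components of a Lovelock tensor. *)
Lemma contract2_product m a b :
  contract2 m.+1 B (l a) (l b) =
  (a == b)%:R * Defs.contract m.+1 fibre +
  4 * m.+1%:R * (\sum_c \sum_e
     X c e * ((a == b)%:R * (c == e)%:R - (a == e)%:R * (c == b)%:R)) *
  ((n%:R - m.*2%:R) * Defs.contract m fibre).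
Proof.
pose G (rho sigma : 'I_(m.+1.*2) -> D) := gdelta R (fcons (l a) rho) (fcons (l b) sigma).
transitivity (\sum_(rho : {ffun 'I_(m.+1.*2) -> D}) \sum_(sigma : {ffun 'I_(m.+1.*2) -> D})
   (G rho sigma * \prod_q slot fibre_part rho sigma q + G rho sigma *
   (\sum_q slot mixed_part rho sigma q *
     \prod_(q' < m.+1 | q' != q) slot fibre_part rho sigma q'))).
  apply: eq_bigr => rho _; apply: eq_bigr => sigma _; rewrite -mulrDr.
  (* Where the delta is nonzero, the fixed base index in front leaves room for at most one more base
     index in each list, which is what [slot_prod_split] asks for. *)
  have [G0|G0] := eqVneq (G rho sigma) 0.
    by rewrite [gdelta _ _ _]G0 G0 !mul0r.
  rewrite -slot_prod_split // => t t' bt bt'; apply/eqP; apply: contraNT G0 => tt'.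
    by rewrite /G (gdelta_base_uniq _ _ bt bt').
  by rewrite /G gdeltaC (gdelta_base_uniq _ _ bt bt').
under eq_bigr => rho _ do rewrite big_split /=.
rewrite big_split /= contract2_fibre; congr (_ + _).
rewrite slot_sum => [|rho sigma p]; last first.
  by rewrite /G !fcons_lift_perm gdelta_perm.
rewrite contract_mixed => [|x y z w|x y z w]; first last.
- rewrite -sumrN; apply: eq_bigr => rho _; rewrite -sumrN; apply: eq_bigr => sigma _.
  rewrite /G (fcons_swap w z) -mulNr; congr (_ * _).
  by rewrite fcons_lift_perm gdelta_permr odd_lift_perm odd_tperm /= mulN1r.
- rewrite -sumrN; apply: eq_bigr => rho _; rewrite -sumrN; apply: eq_bigr => sigma _.
  rewrite /G (fcons_swap y x) -mulNr; congr (_ * _).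
  by rewrite fcons_lift_perm gdelta_perml odd_lift_perm odd_tperm /= mulN1r.
rewrite [4 * m.+1%:R]mulrC -!mulrA; congr (_ * (_ * _)).
rewrite mulr_suml; apply: eq_bigr => c _; rewrite mulr_suml; apply: eq_bigr => e _.
by rewrite -mulrA; congr (_ * _); rewrite -contract4_fibre.
Qed.

End ProductContraction.

(** * Partial derivatives *)

Section PartialDerivatives.
Variable R : realType.

(** The two difference quotients are the same function, so their limits agree whether or not they
    converge. *)
Lemma partial_lshift d1 d2 (F : 'rV[R]_(d1 + d2) -> R) (z : 'rV[R]_(d1 + d2)) i :
  partial (lshift d2 i) F z =
  partial i (fun u => F (row_mx u (rsubmx z))) (lsubmx z).
Proof.
rewrite /partial /derive.
set f1 := (X in lim (X @ _) = _); set f2 := (X in _ = lim (X @ _)).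
suff -> : f1 = f2 by [].
rewrite {}/f1 {}/f2; apply/funext => t /=.
rewrite hsubmxK -{1}[z]hsubmxK delta_mx_lshift scale_row_mx scaler0 add_row_mx.
by rewrite add0r.
Qed.

Lemma partial_rshift d1 d2 (F : 'rV[R]_(d1 + d2) -> R) (z : 'rV[R]_(d1 + d2)) i :
  partial (rshift d1 i) F z =
  partial i (fun x => F (row_mx (lsubmx z) x)) (rsubmx z).
Proof.
rewrite /partial /derive.
set f1 := (X in lim (X @ _) = _); set f2 := (X in _ = lim (X @ _)).
suff -> : f1 = f2 by [].
rewrite {}/f1 {}/f2; apply/funext => t /=.
rewrite hsubmxK -{1}[z]hsubmxK delta_mx_rshift scale_row_mx scaler0 add_row_mx.
by rewrite add0r.
Qed.

Section Rules.
Variables (d : nat) (i : 'I_d).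
Implicit Types (f g : 'rV[R]_d -> R) (z : 'rV[R]_d).

Lemma partial_near (U : set 'rV[R]_d) f g z : open U -> U z ->
  (forall w, U w -> f w = g w) -> partial i f z = partial i g z.
Proof.
by move=> oU Uz fg; apply: near_eq_derive; apply: filterS fg _; exact: open_nbhs_nbhs.
Qed.

Lemma partial_cst x z : partial i (fun=> x) z = 0.
Proof. exact: derive_cst. Qed.

Lemma partialE f z df : is_derive z 'e_i f df -> partial i f z = df.
Proof. by move=> ?; rewrite /partial derive_val. Qed.

Lemma is_partial f z : derivable f z 'e_i -> is_derive z 'e_i f (partial i f z).
Proof. exact: derivableP. Qed.

Lemma is_partialM f g z df dg :
  is_derive z 'e_i f df -> is_derive z 'e_i g dg ->
  is_derive z 'e_i (fun w => f w * g w) (f z * dg + g z * df).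
Proof. exact: is_deriveM. Qed.

Lemma is_partialMl x f z df : is_derive z 'e_i f df ->
  is_derive z 'e_i (fun w => x * f w) (x * df).
Proof. exact: is_deriveZ. Qed.

Lemma is_partialD f g z df dg :
  is_derive z 'e_i f df -> is_derive z 'e_i g dg ->
  is_derive z 'e_i (fun w => f w + g w) (df + dg).
Proof. exact: is_deriveD. Qed.

Lemma is_partialX n f z df : is_derive z 'e_i f df ->
  is_derive z 'e_i (fun w => f w ^+ n) (n%:R * f z ^+ n.-1 * df).
Proof.
move=> fd; have := is_deriveX n fd.
by rewrite (_ : f ^+ n = (fun w => f w ^+ n)) //; apply/funext => w; rewrite exprfctE.
Qed.

Lemma is_partialV f z df : f z != 0 -> is_derive z 'e_i f df ->
  is_derive z 'e_i (fun w => (f w)^-1) (- f z ^- 2 * df).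
Proof.
move=> fz [fd <-]; apply: DeriveDef; first exact: derivableV.
exact: deriveV.
Qed.

Lemma is_partial_sum m (F : 'I_m -> 'rV[R]_d -> R) z dF :
  (forall k, is_derive z 'e_i (F k) (dF k)) ->
  is_derive z 'e_i (fun w => \sum_k F k w) (\sum_k dF k).
Proof.
move=> Fd; have := is_derive_sum Fd.
by rewrite (_ : \sum_k F k = (fun w => \sum_k F k w)) //; apply/funext => w; rewrite fct_sumE.
Qed.

End Rules.
End PartialDerivatives.

(** * Coefficients of the quasilocal mass *)

Section MassCoefficients.
Variables (R : realType) (n : nat) (W : nat -> R).

(** The right-hand side of [contract_pencil] in dimension [n], with the contractions of the Weyl
    tensor replaced by the constants [W]. *)
Definition pencil_sum m (x : R) : R :=
  \sum_(j < m.+1) pencil_coef R n m j * W (m - j) * x ^+ j.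

Definition mass_coef (am : R) m l : R :=
  am * 2 ^- (m - l) / l.+1%:R * 'C(m.-1, l)%:R *
  (\prod_(0 <= p < l.*2.+1) (n.+2 - m.*2 + p)%:R) * W (m.-1 - l).

(* [x ^+ (n + 1 - 2m) * mass_poly] is the m-th summand of the mass at r = x. *)
Definition mass_poly (am : R) m (x : R) : R :=
  (if (m.*2 < n.+1)%N then am / (2 ^+ m.+1 * m%:R) * W m / (n.+1 - m.*2)%:R else 0) +
  \sum_(l < m) mass_coef am m l * x ^+ l.+1.

(** The E of the overview; the powers of [x ^- 2] come from the scaling of the fibre curvature. *)
Definition trace_sum (a : nat -> R) (Lam x k : R) : R :=
  \sum_(1 <= m < (n.+1)./2.+1) a m / (2 ^+ m.+1 * m%:R) *
    ((x ^- 2) ^+ m * pencil_sum m k) - Lam.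

(** The F of the overview: 4 from [contract_mixed], [m] from the position of the mixed slot, and
    [n + 2 - 2m] from the fibre trace left after removing it. *)
Definition hess_sum (a : nat -> R) (x k : R) : R :=
  \sum_(1 <= m < (n.+1)./2.+1) a m / (2 ^+ m.+1 * m%:R) *
    (4 * m%:R * (n.+2 - m.*2)%:R) *
    ((x ^- 2) ^+ m.-1 * pencil_sum m.-1 k) / x.

(** Converts the falling product of [pencil_coef] into the rising one of the mass. The bound keeps
    [q] at most [n], so every factor is an exact natural-number difference. *)
Lemma prod_falling s t : (s + t <= n.+1)%N ->
  \prod_(s <= q < s + t) (n%:R - q%:R) =
  \prod_(0 <= p < t) (n.+1 - (s + t) + p)%:R :> R.
Proof.
move=> st; rewrite -{1}[s]add0n big_addn addKn big_nat_rev /= add0n.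
rewrite !big_nat; apply: eq_bigr => p /andP[_ pt].
rewrite -natrB; last by lia.
by congr (_%:R); lia.
Qed.

Variables (am : R) (m : nat).
Hypotheses (m0 : (0 < m)%N) (mn : (m.*2 <= n.+1)%N).

Let two_exp k : (2 ^+ k : R) != 0. Proof. by rewrite expf_neq0 // pnatr_eq0. Qed.

(** Differentiating the power of [r] produces [n + 1 - 2m], exactly the lowest factor missing from
    the rising product: [2l + 1] factors become the [2l + 2] of [pencil_coef]. *)
Lemma mass_coef_top l : (l < m)%N ->
  (n.+1 - m.*2)%:R * mass_coef am m l =
  am / (2 ^+ m.+1 * m%:R) * (pencil_coef R n m l.+1 * W (m - l.+1)).
Proof.
move=> lm; rewrite /mass_coef /pencil_coef.
have -> : (m.-1 - l = m - l.+1)%N by lia.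
have {3}-> : (m.*2 = (m - l.+1).*2 + l.*2.+2)%N by lia.
rewrite prod_falling; last by lia.
have -> : (n.+1 - ((m - l.+1).*2 + l.*2.+2) = n.+1 - m.*2)%N by lia.
rewrite [in RHS]big_nat_recl // addn0.
rewrite [in RHS](eq_bigr (fun p => (n.+2 - m.*2 + p)%:R)); last first.
  by move=> p _ /=; congr (_%:R); lia.
set P := \prod_(0 <= i < _) _.
have e : l.+1%:R * 'C(m, l.+1)%:R = m%:R * 'C(m.-1, l)%:R :> R.
  by rewrite -!natrM -mul_bin_diag.
have l0 : l.+1%:R != 0 :> R by rewrite pnatr_eq0.
have mr0 : m%:R != 0 :> R by rewrite pnatr_eq0 -lt0n.
have -> : 'C(m, l.+1)%:R = m%:R * 'C(m.-1, l)%:R / l.+1%:R :> R.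
  by rewrite -e mulrAC divff ?mul1r.
have -> : (2 ^- (m - l) : R) = 2 ^+ l.+1 / 2 ^+ m.+1.
  have -> : m.+1 = (l.+1 + (m - l))%N by lia.
  by rewrite exprD invfM mulrA divff // mul1r.
move: (two_exp m.+1) => t0; field.
by rewrite ?nat1r ?l0 mr0 t0.
Qed.

(** Here the rising product loses its lowest factor [n + 2 - 2m] instead, and the [2l] others are
    those of the pencil of order [m - 1]. *)
Lemma mass_coef_deriv l : (l < m)%N ->
  mass_coef am m l * l.+1%:R =
  am / (2 ^+ m.+1 * m%:R) * (2 * m%:R * (n.+2 - m.*2)%:R) *
  (pencil_coef R n m.-1 l * W (m.-1 - l)).
Proof.
move=> lm; rewrite /mass_coef /pencil_coef.
have -> : (m.-1.*2 = (m.-1 - l).*2 + l.*2)%N by lia.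
rewrite prod_falling; last by lia.
rewrite big_nat_recl // addn0.
rewrite [X in _ = _ * (_ * X * _)](eq_bigr (fun p => (n.+2 - m.*2 + p.+1)%:R)); last first.
  by move=> p _ /=; congr (_%:R); lia.
set P := \prod_(0 <= i < _) _.
have l0 : l.+1%:R != 0 :> R by rewrite pnatr_eq0.
have mr0 : m%:R != 0 :> R by rewrite pnatr_eq0 -lt0n.
have -> : (2 ^- (m - l) : R) = 2 * 2 ^+ l / 2 ^+ m.+1.
  have -> : m.+1 = (l.+1 + (m - l))%N by lia.
  by rewrite exprD invfM -exprS mulrA divff // mul1r.
move: (two_exp m.+1) => t0; field.
by rewrite ?nat1r ?l0 mr0 t0.
Qed.

Lemma mass_polyE x : ((n < m.*2)%N -> W m = 0) ->
  (n.+1 - m.*2)%:R * mass_poly am m x =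
  am / (2 ^+ m.+1 * m%:R) * pencil_sum m x.
Proof.
move=> W0; rewrite /mass_poly /pencil_sum big_ord_recl mulrDr [RHS]mulrDr; congr (_ + _).
  rewrite /pencil_coef subn0 bin0 expr0 !mulr1 mul1r big_geq // mul1r ltnS.
  (* For [2m = n + 1] the omitted term of the mass is matched by [W m = 0]. *)
  case: leqP => [mn'|/W0 ->]; last by rewrite !mulr0.
  have d0 : (n.+1 - m.*2)%:R != 0 :> R by rewrite pnatr_eq0; lia.
  by rewrite mulrC mulfVK.
rewrite !mulr_sumr; apply: eq_bigr => l _.
by rewrite mulrA mass_coef_top // !mulrA.
Qed.

Lemma mass_poly_deriv x :
  \sum_(l < m) mass_coef am m l * (l.+1%:R * x ^+ l) =
  am / (2 ^+ m.+1 * m%:R) * (2 * m%:R * (n.+2 - m.*2)%:R) * pencil_sum m.-1 x.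
Proof.
rewrite /pencil_sum prednK // mulr_sumr; apply: eq_bigr => l _.
by rewrite mulrA mass_coef_deriv // !mulrA.
Qed.

End MassCoefficients.

(** * Curvature of the warped product *)

Lemma ord2P (P : 'I_2 -> Prop) : P 0 -> P 1 -> forall c, P c.
Proof.
move=> P0 P1 [[|[|//]] h].
  by rewrite (_ : Ordinal h = 0) //; exact/val_inj.
by rewrite (_ : Ordinal h = 1) //; exact/val_inj.
Qed.

Lemma rev_ord0_2 : rev_ord (0 : 'I_2) = 1.
Proof. exact/val_inj. Qed.

Lemma rev_ord1_2 : rev_ord (1 : 'I_2) = 0.
Proof. exact/val_inj. Qed.

Lemma sum_ord2 (V : nmodType) (F : 'I_2 -> V) : \sum_c F c = F 0 + F 1.
Proof.
rewrite big_ord_recl big_ord1; congr (F _ + F _); exact/val_inj.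
Qed.

Definition ord2E := (rev_ord0_2, rev_ord1_2, sum_ord2).

Definition null_mx (R : ringType) (x : R) : 'M[R]_2 :=
  \matrix_(i, j) (if i == j then 0 else x).

Lemma mul_null_mx (R : fieldType) (x : R) : x != 0 -> null_mx x *m null_mx x^-1 = 1%:M.
Proof.
move=> x0; apply/matrixP; do 2 elim/ord2P;
by rewrite !mxE sum_ord2 !mxE /= !(mul0r, mulr0, add0r, addr0) ?divff.
Qed.

Lemma null_mx_unit (R : fieldType) (x : R) : x != 0 -> null_mx x \in unitmx.
Proof. by move=> /mul_null_mx/mulmx1_unit[]. Qed.

Lemma invmx_null (R : fieldType) (x : R) : x != 0 -> invmx (null_mx x) = null_mx x^-1.
Proof.
move=> x0; apply: (can_inj (mulKmx (null_mx_unit x0))).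
by rewrite mulmxV ?null_mx_unit // mul_null_mx.
Qed.

Section WarpedCurvature.
Variables (R : realType) (n : nat) (U : set 'rV[R]_2) (U' : set 'rV[R]_n).
Variables (gm : 'rV[R]_2 -> 'M[R]_2) (h rr : 'rV[R]_2 -> R) (gam : 'rV[R]_n -> 'M[R]_n).
Hypotheses (oU : open U) (oU' : open U').
Hypothesis gmE : forall u, U u -> gm u = null_mx (h u).
Hypothesis h0 : forall u, U u -> h u != 0.
Hypothesis rr0 : forall u, U u -> rr u != 0.
Hypothesis dh : forall u a, U u -> derivable h u 'e_a.
Hypothesis drr : forall u a, U u -> derivable rr u 'e_a.
Hypothesis ddrr : forall u a b, U u -> derivable (partial b rr) u 'e_a.
Hypothesis gam_unit : forall x, U' x -> gam x \in unitmx.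
Hypothesis gam_sym : forall x, U' x -> (gam x)^T = gam x.
Hypothesis dgam : forall x i j k, U' x -> derivable (fun w => gam w i j) x 'e_k.

Notation l := (@lshift 2 n).
Notation r := (@rshift 2 n).
(** The null metric is off-diagonal, so raising or lowering a base index exchanges the two null
    directions. *)
Notation o := (@rev_ord 2).

Definition warped (z : 'rV[R]_(2 + n)) : 'M[R]_(2 + n) :=
  block_mx (gm (lsubmx z)) 0 0 (rr (lsubmx z) ^+ 2 *: gam (rsubmx z)).

Notation G := warped.
Notation V := [set z : 'rV[R]_(2 + n) | U (lsubmx z) /\ U' (rsubmx z)].

Lemma warped_ll z a b : G z (l a) (l b) = gm (lsubmx z) a b.
Proof. exact: block_mxEul. Qed.
Lemma warped_lr z a i : G z (l a) (r i) = 0.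
Proof. by rewrite /G block_mxEur mxE. Qed.
Lemma warped_rl z a i : G z (r i) (l a) = 0.
Proof. by rewrite /G block_mxEdl mxE. Qed.
Lemma warped_rr z i j : G z (r i) (r j) = rr (lsubmx z) ^+ 2 * gam (rsubmx z) i j.
Proof. by rewrite /G block_mxEdr mxE. Qed.

Lemma warped_inv z : V z ->
  invmx (G z) = block_mx (null_mx (h (lsubmx z))^-1) 0 0
     ((rr (lsubmx z))^-2 *: invmx (gam (rsubmx z))).
Proof.
move=> [Uz U'z].
have u : rr (lsubmx z) ^+ 2 *: gam (rsubmx z) \in unitmx.
  by rewrite unitmxZ ?gam_unit // unitfE expf_neq0 // rr0.
rewrite /G invmx_block_diag ?block_diag_mx_unit ?u ?andbT; last first.
  by rewrite gmE // null_mx_unit ?h0.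
by rewrite gmE // invmx_null ?h0 // invmxZ // exprVn.
Qed.

Lemma winv_ll z a b : V z ->
  invmx (G z) (l a) (l b) = if a == b then 0 else (h (lsubmx z))^-1.
Proof. by move=> Vz; rewrite warped_inv // block_mxEul mxE. Qed.
Lemma winv_lr z a i : V z -> invmx (G z) (l a) (r i) = 0.
Proof. by move=> Vz; rewrite warped_inv // block_mxEur mxE. Qed.
Lemma winv_rl z a i : V z -> invmx (G z) (r i) (l a) = 0.
Proof. by move=> Vz; rewrite warped_inv // block_mxEdl mxE. Qed.
Lemma winv_rr z i j : V z ->
  invmx (G z) (r i) (r j) = rr (lsubmx z) ^- 2 * invmx (gam (rsubmx z)) i j.
Proof. by move=> Vz; rewrite warped_inv // block_mxEdr mxE. Qed.

Lemma winv_suml z a (F : 'I_(2 + n) -> R) : V z ->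
  \sum_k invmx (G z) (l a) k * F k = (h (lsubmx z))^-1 * F (l (o a)).
Proof.
move=> Vz; rewrite big_split_ord /= [X in _ + X]big1 ?addr0 => [|i _].
  rewrite sum_ord2 !winv_ll //.
  by elim/ord2P: a; rewrite !ord2E /= mul0r ?add0r ?addr0.
by rewrite winv_lr // mul0r.
Qed.

Lemma winv_sumr z i (F : 'I_(2 + n) -> R) : V z ->
  \sum_k invmx (G z) (r i) k * F k =
  rr (lsubmx z) ^- 2 * \sum_k invmx (gam (rsubmx z)) i k * F (r k).
Proof.
move=> Vz; rewrite big_split_ord /= big1 ?add0r => [|a _].
  by rewrite mulr_sumr; apply: eq_bigr => j _; rewrite winv_rr // mulrA.
by rewrite winv_rl // mul0r.
Qed.

Lemma gam_invl x i j : U' x -> \sum_k invmx (gam x) i k * gam x k j = (i == j)%:R.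
Proof.
move=> U'x; have /matrixP/(_ i j) := mulVmx (gam_unit U'x).
by rewrite !mxE.
Qed.

Lemma gamC x i j : U' x -> gam x i j = gam x j i.
Proof. by move=> U'x; rewrite -{1}gam_sym // mxE. Qed.

Lemma partial_ll_l z a b c : V z ->
  partial (l c) (fun w => G w (l a) (l b)) z =
  if a == b then 0 else partial c h (lsubmx z).
Proof.
move=> [Uz _]; rewrite partial_lshift.
transitivity (partial c (fun u => if a == b then 0 else h u) (lsubmx z)).
  apply: (partial_near _ oU) => // u Uu.
  by rewrite warped_ll row_mxKl gmE // mxE.
by case: ifP => // _; rewrite partial_cst.
Qed.

Lemma partial_ll_r z a b i : partial (r i) (fun w => G w (l a) (l b)) z = 0.
Proof.
rewrite partial_rshift -[RHS](partial_cst i (gm (lsubmx z) a b) (rsubmx z)).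
by congr partial; apply/funext => x; rewrite warped_ll row_mxKl.
Qed.

Lemma partial_lr z k a i : partial k (fun w => G w (l a) (r i)) z = 0.
Proof.
rewrite -[RHS](partial_cst k 0 z); congr partial.
by apply/funext => x; rewrite warped_lr.
Qed.

Lemma partial_rl z k a i : partial k (fun w => G w (r i) (l a)) z = 0.
Proof.
rewrite -[RHS](partial_cst k 0 z); congr partial.
by apply/funext => x; rewrite warped_rl.
Qed.

Lemma partial_rr_l z c i j : V z ->
  partial (l c) (fun w => G w (r i) (r j)) z =
  2 * rr (lsubmx z) * partial c rr (lsubmx z) * gam (rsubmx z) i j.
Proof.
move=> [Uz U'z]; rewrite partial_lshift.
transitivity (partial c (fun u => gam (rsubmx z) i j * rr u ^+ 2) (lsubmx z)).
  congr partial; apply/funext => u.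
  by rewrite warped_rr row_mxKl row_mxKr mulrC.
rewrite (partialE (is_partialMl _ (is_partialX 2 (is_partial (@drr _ c Uz))))).
by rewrite expr1; ring.
Qed.

Lemma partial_rr_r z k i j : V z ->
  partial (r k) (fun w => G w (r i) (r j)) z =
  rr (lsubmx z) ^+ 2 * partial k (fun x => gam x i j) (rsubmx z).
Proof.
move=> [Uz U'z]; rewrite partial_rshift.
transitivity (partial k (fun x => rr (lsubmx z) ^+ 2 * gam x i j) (rsubmx z)).
  congr partial; apply/funext => u.
  by rewrite warped_rr row_mxKl row_mxKr.
by rewrite (partialE (is_partialMl _ (is_partial (@dgam _ i j k U'z)))).
Qed.

(** * Christoffel symbols of the warped product *)

Lemma christoffel_lll z c a b : V z ->
  christoffel G (l c) (l a) (l b) z =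
  if (a == c) && (b == c) then partial c h (lsubmx z) / h (lsubmx z) else 0.
Proof.
move=> Vz; rewrite /christoffel.
rewrite winv_suml // !partial_ll_l //.
have hz := h0 Vz.1.
by move: c a b; do 3 elim/ord2P; rewrite !ord2E /=; field.
Qed.

Lemma christoffel_rll z k a b : V z -> christoffel G (r k) (l a) (l b) z = 0.
Proof.
move=> Vz; rewrite /christoffel winv_sumr // big1 ?mulr0 // => j _.
by rewrite partial_ll_r !partial_rl // addr0 subr0 mulr0.
Qed.

Lemma christoffel_llr z c a i : V z -> christoffel G (l c) (l a) (r i) z = 0.
Proof.
move=> Vz; rewrite /christoffel winv_suml //.
by rewrite partial_ll_r !partial_lr // addr0 subr0 mulr0 mulr0.
Qed.

Lemma christoffel_lrl z c a i : V z -> christoffel G (l c) (r i) (l a) z = 0.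
Proof.
move=> Vz; rewrite /christoffel winv_suml //.
by rewrite partial_ll_r partial_lr partial_rl addr0 subr0 mulr0 mulr0.
Qed.

Lemma christoffel_rlr z k a i : V z ->
  christoffel G (r k) (l a) (r i) z =
  (k == i)%:R * (partial a rr (lsubmx z) / rr (lsubmx z)).
Proof.
move=> Vz; rewrite /christoffel winv_sumr //.
have rz := rr0 Vz.1.
rewrite -(gam_invl k i Vz.2) mulr_suml !mulr_sumr; apply: eq_bigr => j _.
by rewrite partial_rr_l // partial_rl partial_lr; field.
Qed.

Lemma christoffel_rrl z k a i : V z ->
  christoffel G (r k) (r i) (l a) z =
  (k == i)%:R * (partial a rr (lsubmx z) / rr (lsubmx z)).
Proof.
move=> Vz; rewrite -christoffel_rlr // /christoffel; congr (_ * _).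
apply: eq_bigr => p _; congr (_ * _).
rewrite [X in X - _]addrC; congr (_ - partial p _ z).
by apply/funext => w; rewrite warped_rl warped_lr.
Qed.

Lemma christoffel_lrr z c i j : V z ->
  christoffel G (l c) (r i) (r j) z =
  - (rr (lsubmx z) * partial (o c) rr (lsubmx z) / h (lsubmx z)) * gam (rsubmx z) i j.
Proof.
move=> Vz; rewrite /christoffel winv_suml // !partial_lr partial_rr_l //.
have hz := h0 Vz.1.
by field.
Qed.

Lemma christoffel_rrr z k i j : V z ->
  christoffel G (r k) (r i) (r j) z = christoffel gam k i j (rsubmx z).
Proof.
move=> Vz; rewrite /christoffel winv_sumr //; congr (_ * _).
rewrite mulr_sumr; apply: eq_bigr => p _.
rewrite !partial_rr_r //.
have rz := rr0 Vz.1.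
by field.
Qed.

(** The closed formulas for the Christoffel symbols hold only over the chart images; openness of the
    slice through [z] is what permits differentiating them. *)
Lemma open_partial_l F (Phi : 'rV[R]_2 -> 'rV[R]_n -> R) z d : V z ->
  (forall w, V w -> F w = Phi (lsubmx w) (rsubmx w)) ->
  partial (l d) F z = partial d (Phi^~ (rsubmx z)) (lsubmx z).
Proof.
move=> [Uz U'z] FE; rewrite partial_lshift; apply: (partial_near _ oU) => // u Uu.
by rewrite FE /= ?row_mxKl ?row_mxKr.
Qed.

Lemma open_partial_r F (Phi : 'rV[R]_2 -> 'rV[R]_n -> R) z i : V z ->
  (forall w, V w -> F w = Phi (lsubmx w) (rsubmx w)) ->
  partial (r i) F z = partial i (Phi (lsubmx z)) (rsubmx z).
Proof.
move=> [Uz U'z] FE; rewrite partial_rshift; apply: (partial_near _ oU') => // u Uu.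
by rewrite FE /= ?row_mxKl ?row_mxKr.
Qed.

Lemma sum_pickl (F : 'I_n -> R) k : \sum_q (k == q)%:R * F q = F k.
Proof. by rewrite -[RHS]sum_pick; apply: eq_bigr => q _; rewrite eq_sym. Qed.

Lemma sum_pickr (F : 'I_n -> R) k x : \sum_q F q * ((q == k)%:R * x) = F k * x.
Proof.
rewrite -(sum_pick (fun q => F q * x)); apply: eq_bigr => q _.
by rewrite mulrCA.
Qed.

Lemma gam_invr x i j : U' x -> \sum_k gam x i k * invmx (gam x) k j = (i == j)%:R.
Proof.
move=> U'x; have /matrixP/(_ i j) := mulmxV (gam_unit U'x).
by rewrite !mxE.
Qed.

Lemma partial_gamC x i j k : U' x ->
  partial k (fun w => gam w i j) x = partial k (fun w => gam w j i) x.
Proof. by move=> U'x; apply: (partial_near _ oU') => // w U'w; exact: gamC. Qed.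

Lemma christoffel_gamC x k i j : U' x ->
  christoffel gam k i j x = christoffel gam k j i x.
Proof.
move=> U'x; rewrite /christoffel; congr (_ * _); apply: eq_bigr => p _.
by rewrite [X in X - _]addrC (partial_gamC i j).
Qed.

(** The Christoffel symbols of the first kind. *)
Lemma lower_christoffel x q s i : U' x ->
  \sum_p gam x q p * christoffel gam p s i x =
  2^-1 * (partial s (fun w => gam w q i) x + partial i (fun w => gam w q s) x
          - partial q (fun w => gam w s i) x).
Proof.
move=> U'x; rewrite /christoffel.
pose F p := partial s (fun w => gam w p i) x + partial i (fun w => gam w p s) x
          - partial p (fun w => gam w s i) x.
transitivity (2^-1 * \sum_k (q == k)%:R * F k); last by rewrite sum_pickl.
under eq_bigr => p _ do rewrite mulrCA.
rewrite -mulr_sumr; congr (_ * _).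
under eq_bigr => p _ do rewrite mulr_sumr.
rewrite exchange_big; apply: eq_bigr => k _ /=.
by rewrite -(gam_invr q k U'x) mulr_suml; apply: eq_bigr => p _; rewrite mulrA.
Qed.

(* The only nonzero Christoffel symbols of [null_mx h] are
   [Gamma^c_{cc} = partial c h / h]. *)
Definition hess (d c : 'I_2) (u : 'rV[R]_2) : R :=
  partial d (partial c rr) u -
  if d == c then partial c h u / h u * partial c rr u else 0.

(** This is [(Dr)^2]: the inverse of [null_mx h] has the entry [1 / h] twice, off the diagonal. *)
Definition null_grad (u : 'rV[R]_2) : R := 2 * partial 0 rr u * partial 1 rr u / h u.

(** * Components of the curvature at a point *)

Section AtPoint.
Variable z : 'rV[R]_(2 + n).
Hypothesis Vz : V z.
Let u := lsubmx z.
Let x := rsubmx z.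

(** A Gauss equation: fibre values of the summed index give the curvature of [gam], base values the
    correction by [(Dr)^2]. *)
Lemma riemann_rrrr k q i j :
  riemann G (r k) (r q) (r i) (r j) z =
  riemann gam k q i j x -
  null_grad u * ((k == i)%:R * gam x j q - (k == j)%:R * gam x i q).
Proof.
rewrite /riemann.
rewrite (open_partial_r (Phi := fun _ x => christoffel gam k j q x)) //; last first.
  by move=> w Vw; rewrite (christoffel_rrr _ _ _ Vw).
rewrite (open_partial_r (Phi := fun _ x => christoffel gam k i q x)) //; last first.
  by move=> w Vw; rewrite (christoffel_rrr _ _ _ Vw).
rewrite big_split_ord /= -[RHS]addrA; congr (_ + _).
rewrite addrC; congr (_ + _).
  by apply: eq_bigr => p _; rewrite !(christoffel_rrr _ _ _ Vz).
rewrite sum_ord2 !(christoffel_rrl _ _ _ Vz) !(christoffel_lrr _ _ _ Vz) !ord2E /null_grad -/u -/x.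
have uz : h u != 0 := h0 Vz.1.
have rz : rr u != 0 := rr0 Vz.1.
move: (h u) (rr u) (partial 0 rr u) (partial 1 rr u) uz rz => ? ? ? ? uz rz.
by field; rewrite uz rz.
Qed.

Lemma riemann_lrlr c i d j :
  riemann G (l c) (r i) (l d) (r j) z = - (rr u * hess d (o c) u / h u) * gam x i j.
Proof.
have uz : h u != 0 := h0 Vz.1.
have rz : rr u != 0 := rr0 Vz.1.
rewrite /riemann.
rewrite (open_partial_l (Phi := fun u x =>
   gam x j i * - (rr u * partial (o c) rr u / h u))) //; last first.
  by move=> w Vw; rewrite (christoffel_lrr _ _ _ Vw) mulrC.
rewrite (open_partial_r (Phi := fun _ _ => 0)) //; last first.
  by move=> w Vw; rewrite (christoffel_llr _ _ _ Vw).
rewrite partial_cst.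
rewrite big_split_ord /= [X in _ + (_ + X)](_ : _ =
   (rr u * partial (o c) rr u / h u) * gam x j i * (partial d rr u / rr u)); last first.
  rewrite -(sum_pickr (fun p => rr u * partial (o c) rr u / h u * gam x j p)).
  apply: eq_bigr => p _.
  rewrite (christoffel_llr _ _ _ Vz) (christoffel_lrr _ _ _ Vz).
  by rewrite (christoffel_rlr _ _ _ Vz) mul0r sub0r mulNr mulNr opprK.
rewrite sum_ord2.
rewrite !(christoffel_lrl _ _ _ Vz).
rewrite !(christoffel_lrr _ _ _ Vz).
rewrite !(christoffel_lll _ _ _ Vz).
rewrite !mul0r.
have D : is_derive u 'e_d (fun u => gam x j i * - (rr u * partial (o c) rr u / h u))
   (gam x j i * - (rr u * partial (o c) rr u * (- h u ^- 2 * partial d h u) +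
    (h u)^-1 * (rr u * partial d (partial (o c) rr) u + partial (o c) rr u * partial d rr u))).
  apply: is_partialMl; apply: is_deriveN; apply: is_partialM.
    by apply: is_partialM; apply: is_partial; [exact: drr Vz.1|exact: ddrr Vz.1].
  by apply: is_partialV => //; apply: is_partial; exact: dh Vz.1.
rewrite (partialE D) /hess (gamC j i Vz.2) -/u -/x.
move: (gam x i j) (h u) (rr u) uz rz => ? ? ? uz rz {D}.
by move: c d; do 2 elim/ord2P; rewrite !ord2E /=;
  move: (partial _ (partial _ rr) u) (partial 0 rr u) (partial 1 rr u)
    (partial 0 h u) (partial 1 h u) => ? ? ? ? ?;
  field; rewrite ?uz ?rz.
Qed.

(** Antisymmetry in the first index pair is not visible in the definition of [riemann], so this
    order is computed directly; in the last pair it is, and [riemann22C] exploits it. *)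
Lemma riemann_rllr c i d j :
  riemann G (r i) (l c) (l d) (r j) z = (i == j)%:R * (hess d c u / rr u).
Proof.
have uz : h u != 0 := h0 Vz.1.
have rz : rr u != 0 := rr0 Vz.1.
rewrite /riemann.
rewrite (open_partial_l (Phi := fun u x =>
   (i == j)%:R * (partial c rr u / rr u))) //; last first.
  by move=> w Vw; rewrite (christoffel_rrl _ _ _ Vw).
rewrite (open_partial_r (Phi := fun _ _ => 0)) //; last first.
  by move=> w Vw; rewrite (christoffel_rll _ _ _ Vw).
rewrite partial_cst.
rewrite big_split_ord /= [X in _ + (_ + X)](_ : _ =
   (i == j)%:R * (partial d rr u / rr u) * (partial c rr u / rr u)); last first.
  rewrite -(sum_pickr (fun p => (i == p)%:R * (partial d rr u / rr u))).
  apply: eq_bigr => p _.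
  rewrite (christoffel_rlr _ _ _ Vz) (christoffel_rrl _ _ _ Vz).
  by rewrite (christoffel_rll _ _ _ Vz) mulr0 subr0.
rewrite sum_ord2.
rewrite !(christoffel_rrl _ _ _ Vz).
rewrite !(christoffel_rll _ _ _ Vz).
rewrite !(christoffel_lll _ _ _ Vz).
rewrite !mul0r.
have D : is_derive u 'e_d (fun u => (i == j)%:R * (partial c rr u / rr u))
   ((i == j)%:R * (partial c rr u * (- rr u ^- 2 * partial d rr u) +
    (rr u)^-1 * partial d (partial c rr) u)).
  apply: is_partialMl; apply: is_partialM.
    by apply: is_partial; exact: ddrr Vz.1.
  by apply: is_partialV => //; apply: is_partial; exact: drr Vz.1.
rewrite (partialE D) /hess -/u -/x.
move: (_ == _)%:R (h u) (rr u) uz rz => ? ? ? uz rz {D}.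
by move: c d; do 2 elim/ord2P; rewrite ?ord2E /=;
  move: (partial _ (partial _ rr) u) (partial 0 rr u) (partial 1 rr u)
    (partial 0 h u) (partial 1 h u) => ? ? ? ? ?;
  field; rewrite ?uz ?rz.
Qed.

(** A Codazzi equation: the factor in front of [gam] is constant along the fibre, and the
    derivatives of [gam] cancel against its Christoffel symbols of the first kind. *)
Lemma riemann_lrrr c i q s : riemann G (l c) (r i) (r q) (r s) z = 0.
Proof.
have uz : h u != 0 := h0 Vz.1.
rewrite /riemann.
pose k := - (rr u * partial (o c) rr u / h u).
rewrite (open_partial_r (Phi := fun u x =>
   - (rr u * partial (o c) rr u / h u) * gam x s i)) //; last first.
  by move=> w Vw; rewrite (christoffel_lrr _ _ _ Vw).
rewrite (open_partial_r (Phi := fun u x =>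
   - (rr u * partial (o c) rr u / h u) * gam x q i)) //; last first.
  by move=> w Vw; rewrite (christoffel_lrr _ _ _ Vw).
rewrite !(partialE (is_partialMl _ (is_partial (@dgam _ _ _ _ Vz.2)))) -/u -/x -/k.
rewrite big_split_ord /= big1 ?add0r => [|e _]; last first.
  by rewrite !(christoffel_lrl _ _ _ Vz) !mul0r subr0.
rewrite (eq_bigr (fun p => k * (gam x q p * christoffel gam p s i x) -
     k * (gam x s p * christoffel gam p q i x))) => [|p _]; last first.
  by rewrite !(christoffel_lrr _ _ _ Vz) !(christoffel_rrr _ _ _ Vz) -/k -/x !mulrA.
rewrite sumrB -!mulr_sumr !lower_christoffel ?Vz.2 //; try exact: Vz.2.
rewrite (partial_gamC q s i Vz.2).
by field.
Qed.

Lemma riemann_rlrr c i q s : riemann G (r i) (l c) (r q) (r s) z = 0.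
Proof.
rewrite /riemann.
rewrite (open_partial_r (Phi := fun u x => (i == s)%:R * (partial c rr u / rr u))) //; last first.
  by move=> w Vw; rewrite (christoffel_rrl _ _ _ Vw).
rewrite (open_partial_r (Phi := fun u x => (i == q)%:R * (partial c rr u / rr u))) //; last first.
  by move=> w Vw; rewrite (christoffel_rrl _ _ _ Vw).
rewrite !partial_cst subr0 add0r big_split_ord /= big1 ?add0r => [|e _]; last first.
  by rewrite !(christoffel_lrl _ _ _ Vz) !mulr0 subr0.
under eq_bigr => p _ do rewrite !(christoffel_rrr _ _ _ Vz) !(christoffel_rrl _ _ _ Vz).
by rewrite sumrB !sum_pickr christoffel_gamC ?subrr //; exact: Vz.2.
Qed.

Lemma riemann_rrlr d i j s : riemann G (r i) (r j) (l d) (r s) z = 0.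
Proof.
rewrite /riemann.
rewrite (open_partial_l (Phi := fun u x => christoffel gam i s j x)) //; last first.
  by move=> w Vw; rewrite (christoffel_rrr _ _ _ Vw).
rewrite (open_partial_r (Phi := fun u x => (i == j)%:R * (partial d rr u / rr u))) //; last first.
  by move=> w Vw; rewrite (christoffel_rlr _ _ _ Vw).
rewrite !partial_cst subr0 add0r big_split_ord /= big1 ?add0r => [|e _]; last first.
  by rewrite (christoffel_rll _ _ _ Vz) (christoffel_llr _ _ _ Vz) mul0r mulr0 subr0.
under eq_bigr => p _ do rewrite !(christoffel_rrr _ _ _ Vz) !(christoffel_rlr _ _ _ Vz) -mulrA.
by rewrite sumrB sum_pickr sum_pickl mulrC subrr.
Qed.

Lemma riemann22E i j k m :
  riemann22 G z i j k m = \sum_p G z i p *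
    \sum_q (\sum_s riemann G p j q s z * invmx (G z) s m) * invmx (G z) q k.
Proof.
apply: eq_bigr => p _; rewrite mulr_sumr; apply: eq_bigr => q _.
rewrite mulr_suml mulr_sumr; apply: eq_bigr => s _.
by rewrite [in RHS]mulrAC !mulrA.
Qed.

Lemma riemann22C i j k m : riemann22 G z i j m k = - riemann22 G z i j k m.
Proof.
rewrite /riemann22 -sumrN; apply: eq_bigr => p _.
rewrite exchange_big -sumrN; apply: eq_bigr => q _.
rewrite -sumrN; apply: eq_bigr => s _.
rewrite (_ : riemann G p j s q z = - riemann G p j q s z).
  by rewrite mulrN !mulNr; congr (- _); rewrite mulrAC.
rewrite /riemann opprD opprB; congr (_ + _); rewrite -sumrN.
by apply: eq_bigr => t _; rewrite opprB.
Qed.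

Lemma warped_suml c (F : 'I_(2 + n) -> R) :
  \sum_p G z (l c) p * F p = h u * F (l (o c)).
Proof.
rewrite big_split_ord /= [X in _ + X]big1 ?addr0 => [|i _].
  rewrite sum_ord2 !warped_ll // gmE ?Vz.1 //; last exact: Vz.1.
  by rewrite !mxE; elim/ord2P: c; rewrite !ord2E /= mul0r ?add0r ?addr0.
by rewrite warped_lr // mul0r.
Qed.

Lemma warped_sumr i (F : 'I_(2 + n) -> R) :
  \sum_p G z (r i) p * F p = rr u ^+ 2 * \sum_p gam x i p * F (r p).
Proof.
rewrite big_split_ord /= big1 ?add0r => [|a _].
  by rewrite mulr_sumr; apply: eq_bigr => j _; rewrite warped_rr // mulrA.
by rewrite warped_rl // mul0r.
Qed.

Lemma winv_sum_l c (F : 'I_(2 + n) -> R) :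
  \sum_q F q * invmx (G z) q (l c) = F (l (o c)) / h u.
Proof.
rewrite big_split_ord /= [X in _ + X]big1 ?addr0 => [|i _].
  rewrite sum_ord2 !winv_ll //.
  by elim/ord2P: c; rewrite !ord2E /= mulr0 ?add0r ?addr0.
by rewrite winv_rl // mulr0.
Qed.

Lemma winv_sum_r i (F : 'I_(2 + n) -> R) :
  \sum_q F q * invmx (G z) q (r i) =
  rr u ^- 2 * \sum_q F (r q) * invmx (gam x) q i.
Proof.
rewrite big_split_ord /= big1 ?add0r => [|a _].
  by rewrite mulr_sumr; apply: eq_bigr => j _; rewrite winv_rr // mulrCA.
by rewrite winv_lr // mulr0.
Qed.

Lemma riemann22_lrlr c i e j :
  riemann22 G z (l c) (r i) (l e) (r j) =
  - (hess (o e) c u / (rr u * h u)) * (i == j)%:R.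
Proof.
have uz : h u != 0 := h0 Vz.1.
have rz : rr u != 0 := rr0 Vz.1.
rewrite riemann22E warped_suml winv_sum_l winv_sum_r.
rewrite -(gam_invr i j Vz.2) mulr_sumr mulr_suml !mulr_sumr; apply: eq_bigr => k _.
by rewrite riemann_lrlr rev_ordK -/u -/x; field; rewrite rz uz.
Qed.

Lemma riemann22_rllr c i e j :
  riemann22 G z (r i) (l c) (l e) (r j) =
  hess (o e) c u / (rr u * h u) * (i == j)%:R.
Proof.
have uz : h u != 0 := h0 Vz.1.
have rz : rr u != 0 := rr0 Vz.1.
rewrite riemann22E warped_sumr.
rewrite -(gam_invr i j Vz.2) !mulr_sumr; apply: eq_bigr => p _.
rewrite winv_sum_l winv_sum_r.
rewrite (_ : \sum_q _ = hess (o e) c u / rr u * invmx (gam x) p j).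
  by rewrite -/u -/x; field; rewrite rz uz.
rewrite -(sum_pickl (fun q => hess (o e) c u / rr u * invmx (gam x) q j)).
by apply: eq_bigr => k _; rewrite riemann_rllr -/u; ring.
Qed.

Lemma riemann22_balanced i j k m :
  ~~ (base i && base j) -> ~~ (base k && base m) ->
  base i || base j != base k || base m -> riemann22 G z i j k m = 0.
Proof.
have Zu (F : 'I_n -> R) : (forall q, F q = 0) -> \sum_q F q = 0.
  by move=> F0; rewrite big1.
have A1 c i' p q : riemann22 G z (l c) (r i') (r p) (r q) = 0.
  rewrite riemann22E warped_suml winv_sum_r Zu ?(mulr0, mul0r) ?(mulr0, mul0r) // => ?.
  rewrite winv_sum_r Zu ?(mulr0, mul0r) ?(mulr0, mul0r) // => ?.
  by rewrite riemann_lrrr mul0r.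
have A2 c i' p q : riemann22 G z (r i') (l c) (r p) (r q) = 0.
  rewrite riemann22E warped_sumr Zu ?(mulr0, mul0r) ?(mulr0, mul0r) // => ?.
  rewrite winv_sum_r Zu ?(mulr0, mul0r) ?(mulr0, mul0r) // => ?.
  rewrite winv_sum_r Zu ?(mulr0, mul0r) ?(mulr0, mul0r) // => ?.
  by rewrite riemann_rlrr mul0r.
have A3 c i' p q : riemann22 G z (r i') (r p) (l c) (r q) = 0.
  rewrite riemann22E warped_sumr Zu ?(mulr0, mul0r) ?(mulr0, mul0r) // => ?.
  rewrite winv_sum_l winv_sum_r Zu ?(mulr0, mul0r) ?(mulr0, mul0r) // => ?.
  by rewrite riemann_rrlr mul0r.
case: (split_ordP i) => ? ->; case: (split_ordP j) => ? ->;
case: (split_ordP k) => ? ->; case: (split_ordP m) => ? ->;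
by rewrite ?base_l ?base_r //= ?A1 ?A2 ?A3 // riemann22C A3 oppr0.
Qed.

Lemma riemann22_fibre i j k m :
  riemann22 G z (r i) (r j) (r k) (r m) =
  rr u ^- 2 * (riemann22 gam x i j k m - null_grad u * delta2 R i j k m).
Proof.
have rz : rr u != 0 := rr0 Vz.1.
have U'x : U' x := Vz.2.
rewrite riemann22E warped_sumr.
pose D p q s : R := (p == q)%:R * gam x s j - (p == s)%:R * gam x q j.
transitivity (rr u ^- 2 * (\sum_p gam x i p * \sum_q (\sum_s
   (riemann gam p j q s x - null_grad u * D p q s) * invmx (gam x) s m) *
      invmx (gam x) q k)).
  rewrite !mulr_sumr; apply: eq_bigr => p _.
  rewrite winv_sum_r [in RHS]mulrCA [in LHS]mulrCA; congr (gam x i p * _).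
  (* The [r^2] from lowering one index cancels one of the two [r^-2] from raising two. *)
  rewrite mulrA divff ?expf_neq0 // mul1r mulr_sumr; apply: eq_bigr => q _.
  rewrite winv_sum_r -/x mulrA; congr (_ * _ * _).
  by apply: eq_bigr => s _; rewrite riemann_rrrr.
congr (_ * _).
have E1 p q : \sum_s (riemann gam p j q s x - null_grad u * D p q s) * invmx (gam x) s m =
   \sum_s riemann gam p j q s x * invmx (gam x) s m -
   null_grad u * \sum_s D p q s * invmx (gam x) s m.
  rewrite mulr_sumr -sumrB; apply: eq_bigr => s _.
  by rewrite mulrBl mulrA.
have E2 p q : \sum_s D p q s * invmx (gam x) s m =
   (p == q)%:R * (j == m)%:R - gam x q j * invmx (gam x) p m.
  rewrite -(gam_invr j m U'x) mulr_sumr.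
  rewrite -(sum_pickl (fun s => gam x q j * invmx (gam x) s m) p) -sumrB.
  apply: eq_bigr => s _; rewrite /D mulrBl !mulrA (gamC s j U'x).
  by congr (_ - _); have [->|] := eqVneq p s; rewrite ?mul1r ?mul0r.
transitivity (\sum_p gam x i p *
    \sum_q (\sum_s riemann gam p j q s x * invmx (gam x) s m) * invmx (gam x) q k
  - null_grad u * \sum_p gam x i p *
    \sum_q ((p == q)%:R * (j == m)%:R - gam x q j * invmx (gam x) p m)
      * invmx (gam x) q k).
  rewrite mulr_sumr -sumrB; apply: eq_bigr => p _.
  rewrite mulrCA -mulrBr; congr (_ * _); rewrite mulr_sumr -sumrB.
  by apply: eq_bigr => q _; rewrite E1 E2 mulrBl mulrA.
congr (_ - _ * _).
  apply: eq_bigr => p _; rewrite mulr_sumr; apply: eq_bigr => q _.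
  rewrite mulr_suml mulr_sumr; apply: eq_bigr => s _.
  by rewrite [in LHS]mulrAC !mulrA.
have E3 p : \sum_q ((p == q)%:R * (j == m)%:R - gam x q j * invmx (gam x) p m) * invmx (gam x) q k
  = (j == m)%:R * invmx (gam x) p k - invmx (gam x) p m * (j == k)%:R.
  rewrite -(gam_invr j k U'x) mulr_sumr.
  rewrite -(sum_pickl (fun q => (j == m)%:R * invmx (gam x) q k) p) -sumrB.
  by apply: eq_bigr => q _; rewrite (gamC q j U'x); ring.
under eq_bigr => p _ do rewrite E3 mulrBr.
rewrite sumrB /delta2 ![_ == i]eq_sym ![_ == j]eq_sym.
rewrite -(gam_invr i k U'x) -(gam_invr i m U'x) !mulr_suml mulr_sumr; congr (_ - _).
  by apply: eq_bigr => p _; ring.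
by apply: eq_bigr => p _; ring.
Qed.

End AtPoint.

(** * Base components of the Lovelock tensor *)

Section LovelockBase.
Variables (a : nat -> R) (Lam kap : R) (W : nat -> R) (z : 'rV[R]_(2 + n)).
Hypothesis Vz : V z.
Let u := lsubmx z.
Let x := rsubmx z.
Hypothesis WE : forall m, Defs.contract m (weyl22 gam kap x) = W m.

Let kappa := kap - null_grad u.

Lemma contract_warped_fibre m :
  Defs.contract m (fibre (riemann22 G z)) = (rr u ^- 2) ^+ m * pencil_sum n W m kappa.
Proof.
transitivity (Defs.contract m (fun i j k l => rr u ^- 2 *
    (weyl22 gam kap x i j k l + kappa * delta2 R i j k l))).
  congr Defs.contract; do 4 apply/funext => ?.
  by rewrite /fibre riemann22_fibre // /weyl22 /kappa /delta2; ring.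
rewrite contract_scale contract_pencil; congr (_ * _).
by apply: eq_bigr => j _; rewrite WE.
Qed.

(* [delta^{be}_{cd} X_e^d], up to the factor of the metric raising [d]. *)
Definition hess_cotrace (b c : 'I_2) : R :=
  \sum_e \sum_d hess (o d) e u *
    ((b == c)%:R * (e == d)%:R - (b == d)%:R * (e == c)%:R).

Lemma contract2_warped m b c :
  contract2 m.+1 (riemann22 G z) (l b) (l c) =
  (b == c)%:R * ((rr u ^- 2) ^+ m.+1 * pencil_sum n W m.+1 kappa) -
  4 * m.+1%:R * (hess_cotrace b c / (rr u * h u)) *
  ((n%:R - m.*2%:R) * ((rr u ^- 2) ^+ m * pencil_sum n W m kappa)).
Proof.
rewrite (@contract2_product R n _ (riemann22_balanced Vz)
  (fun c e => - (hess (o e) c u / (rr u * h u)))).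
- rewrite !contract_warped_fibre -mulNr -mulrN; congr (_ + 4 * _ * _ * _).
  rewrite /hess_cotrace mulr_suml -sumrN; apply: eq_bigr => e _.
  by rewrite mulr_suml -sumrN; apply: eq_bigr => d _; rewrite -!mulNr mulrAC.
- by move=> *; rewrite riemann22_lrlr.
- by move=> *; rewrite riemann22_rllr // mulNr opprK.
- by move=> *; rewrite riemann22C riemann22_lrlr.
- by move=> *; rewrite riemann22C riemann22_rllr // mulNr.
Qed.

Notation lovelock_trace := (trace_sum n W a Lam (rr u) kappa).
Notation lovelock_hess := (hess_sum n W a (rr u) kappa).

Lemma lovelock_base b c :
  lovelock G a Lam z (l b) (l c) =
  - ((b == c)%:R * lovelock_trace) + lovelock_hess * hess_cotrace b c / h u.
Proof.
have uz : h u != 0 := h0 Vz.1.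
have rz : rr u != 0 := rr0 Vz.1.
rewrite mxE (inj_eq (@lshift_inj _ _)).
rewrite [X in - X + _](_ : _ = (b == c)%:R * (lovelock_trace + Lam) -
    lovelock_hess * hess_cotrace b c / h u); first by ring.
rewrite /trace_sum /hess_sum subrK mulr_sumr !mulr_suml -sumrB.
rewrite !big_nat; apply: eq_bigr => -[//|m] /andP[_ mn].
have {}mn : (m.*2 < n)%N by lia.
rewrite contract2_warped (_ : (n.+2 - m.+1.*2 = n - m.*2)%N); last by lia.
rewrite natrB ?(ltnW mn) //=.
have m0 : m.+1%:R != 0 :> R by rewrite pnatr_eq0.
move: (pencil_sum _ _ _ _) (pencil_sum _ _ _ _) (_ ^+ m.+1) (_ ^+ m) => A B C D.
move: (hess_cotrace b c) (b == c)%:R (m.*2%:R) => e f k.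
by field; rewrite nat1r uz rz m0 expf_neq0 // pnatr_eq0.
Qed.

(** The diagonal null components of the metric vanish, so [T_uu] and [T_vv] see only the Hessian. In
    [T_uv] the term [g_uv D^c D_c r] equals [2 D_u D_v r], which turns the sign of the Hessian into
    plus. *)
Lemma lovelock_lower (T : 'M[R]_2) :
  (forall b c, (G z *m lovelock G a Lam z) (l b) (l c) = T b c) ->
  [/\ T 0 0 = - lovelock_hess * hess 0 0 u,
      T 0 1 = - h u * lovelock_trace + lovelock_hess * hess 1 0 u,
      T 1 0 = - h u * lovelock_trace + lovelock_hess * hess 0 1 u &
      T 1 1 = - lovelock_hess * hess 1 1 u].
Proof.
move=> TE; have uz : h u != 0 := h0 Vz.1.
have E b c : T b c = h u * lovelock G a Lam z (l (o b)) (l c).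
  by rewrite -TE mxE warped_suml.
(* With two base values only one term of the double delta survives: on the diagonal the index
   opposite to [b], off the diagonal [e = c] and [d = b], where [o b = c]. *)
have C b c : hess_cotrace b c =
    if b == c then hess b (o b) u else - hess c c u.
  rewrite /hess_cotrace; move: hess => H; rewrite !sum_ord2.
  by elim/ord2P: b; elim/ord2P: c; rewrite !(rev_ord0_2, rev_ord1_2) /=; ring.
split; rewrite E lovelock_base C ?(rev_ord0_2, rev_ord1_2) /=;
move: (trace_sum _ _ _ _ _ _) (hess_sum _ _ _ _ _) hess (h u) uz => ? ? H ? uz; by field.
Qed.

End LovelockBase.

End WarpedCurvature.

(** * Derivative of the mass *)

Section MassDerivative.
Variables (R : realType) (n : nat) (a : nat -> R) (Lam V : R) (W : nat -> R).

(** The mass with [r] and [kap - (Dr)^2] as independent arguments, ready for the chain rule. *)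
Definition mass_value (x k : R) : R :=
  V * (\sum_(1 <= m < (n.+1)./2.+1)
         x ^+ (n.+1 - m.*2) * mass_poly n W (a m) m k
       - x ^+ n.+1 / n.+1%:R * Lam).

Lemma mass_valueE (X : manifold R 2) (kap : R) (g : chart R 2 X -> X -> 'M[R]_2)
    (r : X -> R) (c : chart R 2 X) (z : 'rV[R]_2) :
  mass n a Lam kap V W g r c z =
  mass_value (r (cparam c z))
    (kap - grad_sq (in_coord g c) (fun w => r (cparam c w)) z).
Proof.
rewrite /mass /mass_value; set x := r _; set k := kap - _.
rewrite addrAC; congr (_ * (_ - _)).
rewrite big_mkcond -big_split /=; apply: eq_bigr => m _.
rewrite /mass_poly mulrDr; congr (_ + _).
  by case: ifP => _; rewrite ?mulr0 //; ring.
rewrite big_mkord mulr_sumr; apply: eq_bigr => l _.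
by rewrite /mass_coef; ring.
Qed.

Hypothesis W0 : forall m, (n < m.*2)%N -> W m = 0.

Lemma is_partial_mass (rho kappa : 'rV[R]_2 -> R) (u : 'rV[R]_2) i drho dkappa :
  rho u != 0 ->
  is_derive u 'e_i rho drho -> is_derive u 'e_i kappa dkappa ->
  is_derive u 'e_i (fun w => mass_value (rho w) (kappa w))
    (V * rho u ^+ n * (trace_sum n W a Lam (rho u) (kappa u) * drho +
                       hess_sum n W a (rho u) (kappa u) / 2 * dkappa)).
Proof.
move=> x0 Dr Dk; rewrite /mass_value.
pose N m := (n.+1 - m.+1.*2)%N.
pose dS m := (N m)%:R * rho u ^+ (N m).-1 * drho * mass_poly n W (a m.+1) m.+1 (kappa u) +
  rho u ^+ N m * (\sum_(l < m.+1) mass_coef n W (a m.+1) m.+1 l *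
     (l.+1%:R * kappa u ^+ l * dkappa)).
have D : is_derive u 'e_i (fun w => V * (\sum_(m < (n.+1)./2)
         rho w ^+ N m * mass_poly n W (a m.+1) m.+1 (kappa w)
       + (- (Lam / n.+1%:R)) * rho w ^+ n.+1))
   (V * (\sum_(m < (n.+1)./2) dS m + (- (Lam / n.+1%:R)) * (n.+1%:R * rho u ^+ n * drho))).
  apply: is_partialMl; apply: is_partialD; last first.
    by apply: is_partialMl; exact: is_partialX.
  apply: is_partial_sum => m; rewrite /dS addrC.
  rewrite [_ * drho * _]mulrC; apply: is_partialM; first exact: is_partialX.
  rewrite /mass_poly -[X in is_derive _ _ _ X]add0r; apply: is_partialD.
  by apply: is_partial_sum => l; apply: is_partialMl; exact: is_partialX.
have F : (fun w => V * (\sum_(m < (n.+1)./2)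
         rho w ^+ N m * mass_poly n W (a m.+1) m.+1 (kappa w)
       + (- (Lam / n.+1%:R)) * rho w ^+ n.+1)) = (fun w => V * (\sum_(1 <= m < (n.+1)./2.+1)
         rho w ^+ (n.+1 - m.*2) * mass_poly n W (a m) m (kappa w)
       - rho w ^+ n.+1 / n.+1%:R * Lam)).
  apply/funext => w; rewrite big_add1 big_mkord; congr (_ * (_ + _)).
  by rewrite mulNr; congr (- _); rewrite mulrC mulrA mulrAC.
rewrite F in D; apply: (is_derive_eq D); rewrite -[RHS]mulrA; congr (_ * _).
rewrite /trace_sum /hess_sum !big_add1 !big_mkord /=.
have n0 : n.+1%:R != 0 :> R by rewrite pnatr_eq0.
have -> : - (Lam / n.+1%:R) * (n.+1%:R * rho u ^+ n * drho) = - (rho u ^+ n * Lam * drho).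
  by move: (n.+1%:R) n0 (rho u ^+ n) => k k0 y; field.
pose Tm m := a m.+1 / (2 ^+ m.+2 * m.+1%:R) *
    ((rho u ^- 2) ^+ m.+1 * pencil_sum n W m.+1 (kappa u)).
pose Hm m := a m.+1 / (2 ^+ m.+2 * m.+1%:R) * (4 * m.+1%:R * (n.+2 - m.+1.*2)%:R) *
    ((rho u ^- 2) ^+ m * pencil_sum n W m (kappa u)) / rho u.
(* The identity holds separately at each order [m]. *)
rewrite (eq_bigr (fun m : 'I_ _ => rho u ^+ n * drho * Tm m + rho u ^+ n / 2 * dkappa * Hm m)).
  by rewrite big_split -!mulr_sumr /=; ring.
move=> -[m /= mK] _; rewrite /dS /Tm /Hm.
have mn : (m.+1.*2 <= n.+1)%N by lia.
have E1 := mass_polyE (a m.+1) (ltn0Sn m) mn (kappa u) (@W0 m.+1).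
have E2 := mass_poly_deriv W (a m.+1) (ltn0Sn m) mn (kappa u).
rewrite /= in E2.
have -> : \sum_(l < m.+1) mass_coef n W (a m.+1) m.+1 l * (l.+1%:R * kappa u ^+ l * dkappa) =
    (\sum_(l < m.+1) mass_coef n W (a m.+1) m.+1 l * (l.+1%:R * kappa u ^+ l)) * dkappa.
  by rewrite mulr_suml; apply: eq_bigr => l _; rewrite !mulrA.
rewrite E2; congr (_ + _).
  have -> : (N m)%:R * rho u ^+ (N m).-1 * drho * mass_poly n W (a m.+1) m.+1 (kappa u) =
     rho u ^+ (N m).-1 * drho * ((N m)%:R * mass_poly n W (a m.+1) m.+1 (kappa u)) by ring.
  (* At [N m = 0] the exponent [(N m).-1] is truncated and the powers of [r] do not match, but then
     [E1] makes both sides vanish. *)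
  rewrite E1; case: (posnP (N m)) => [N0|N0].
    by move: E1; rewrite -/(N m) N0 mul0r => E1; rewrite [X in _ = _ * X]mulrCA -E1 !mulr0.
  have -> : rho u ^+ n = rho u ^+ (N m).-1 * (rho u ^+ 2) ^+ m.+1.
    by rewrite -exprM -exprD; congr (_ ^+ _); rewrite /N in N0 *; lia.
  have t0 : (rho u ^+ 2) ^+ m.+1 != 0 by rewrite !expf_neq0.
  rewrite exprVn; move: (_ ^+ m.+1) t0 (pencil_sum _ _ _ _) (a _ / _) (rho u ^+ _) => k k0 p q y.
  by field.
(* The odd factor [rho u] cancels the division by [x] in [hess_sum]. *)
have -> : rho u ^+ n = rho u ^+ N m * rho u * (rho u ^+ 2) ^+ m.
  by rewrite -exprM -exprSr -exprD; congr (_ ^+ _); rewrite /N; lia.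
have t0 : (rho u ^+ 2) ^+ m != 0 by rewrite !expf_neq0.
rewrite exprVn.
move: (rho u ^+ N m) (_ ^+ m) t0 (pencil_sum _ _ _ _) (a _ / _) (_ - _)%:R => y k k0 p q e.
by field; rewrite x0 k0.
Qed.

End MassDerivative.

(** * Monotonicity *)

Lemma smooth_on_derivable (R : realType) d (U : set 'rV[R]_d) (f : 'rV[R]_d -> R) s u i :
  smooth_on U f -> U u -> derivable (foldr (@partial R d) f s) u 'e_i.
Proof. by move=> sf Uu; exact/diff_derivable/sf. Qed.

Lemma riemannian_unitmx (R : realType) d (X : manifold R d)
    (g : chart R d X -> X -> 'M[R]_d) c y :
  riemannian_metric g -> atlas c -> cdom c y -> g c y \in unitmx.
Proof.
move=> [_ gpos] ac cy; rewrite unitmxE unitfE; apply/negP => /det0P[v v0 vg].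
have w0 : v^T != 0 by rewrite -(inj_eq (@trmx_inj _ _ _)) trmxK trmx0.
by have := gpos c y ac cy _ w0; rewrite trmxK vg mul0mx mxE ltxx.
Qed.

Lemma bil_null (R : realType) (x : R) (v w : 'cV[R]_2) :
  bil (null_mx x) v w = x * (v 0 0 * w 1 0 + v 1 0 * w 0 0).
Proof.
rewrite /bil mxE sum_ord2 !mxE !sum_ord2 !mxE /=; ring.
Qed.

Lemma bil_block (R : realType) m n (A : 'M[R]_m) (B : 'M[R]_n) (v w : 'cV[R]_m) :
  bil (block_mx A 0 0 B) (col_mx v 0) (col_mx w 0) = bil A v w.
Proof.
rewrite /bil tr_col_mx trmx0 mul_row_block !mul0mx mulmx0 addr0 add0r.
by rewrite mul_row_col mulmx0 addr0.
Qed.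

Section NullEnergy.
Variables (R : realType) (h : R) (tau : 'cV[R]_2) (T : 'M[R]_2).
Hypotheses (h_neg : h < 0) (tau0 : 0 < tau 0 0) (tau1 : 0 < tau 1 0).

(** Causality makes the product of the null components nonnegative, and future direction makes a
    combination of them with positive weights positive; a negative component would force the other
    to be nonpositive and spoil the second. *)
Lemma causal_future_null (j : 'cV[R]_2) :
  j = 0 \/ (causal (null_mx h) j /\ future_directed (null_mx h) tau j) ->
  0 <= j 0 0 /\ 0 <= j 1 0.
Proof.
case=> [->|[[_ jj] tj]]; first by rewrite !mxE.
move: jj tj; rewrite /future_directed !bil_null nmulr_rle0 // nmulr_rlt0 //.
move: (j 0 0) (j 1 0) (tau 0 0) (tau 1 0) tau0 tau1 => p q s t s0 t0 pq st.
have pq0 : 0 <= p * q by lra.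
split; rewrite leNgt; apply/negP => neg.
  have q0 : q <= 0 by rewrite -(nmulr_rge0 _ neg).
  have : s * q <= 0 by rewrite pmulr_rle0.
  have : t * p < 0 by rewrite pmulr_rlt0.
  lra.
have p0 : p <= 0 by rewrite -(nmulr_lge0 _ neg).
have : t * p <= 0 by rewrite pmulr_rle0.
have : s * q < 0 by rewrite pmulr_rlt0.
lra.
Qed.

End NullEnergy.

Unset Implicit Arguments.

Theorem proposition1 (R : realType) (n : nat) (hn : (4 <= n)%N)
  (a : nat -> R) (ha1 : a 1%N = 1) (Lam : R)
  (X : manifold R 2)
  (g : chart R 2 X -> X -> 'M[R]_2) (hg : lorentzian_metric g)
  (O : set (chart R 2 X)) (hO : orientation O)
  (tau : chart R 2 X -> X -> 'cV[R]_2) (htau : time_orientation g tau)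
  (r : X -> R) (hr : smooth_fun r) (hr0 : forall y, 0 < r y)
  (K : manifold R n) (hK : compact [set: K])
  (gam : chart R n K -> K -> 'M[R]_n) (hgam : riemannian_metric gam)
  (kap : R) (hkap : [\/ kap = -1, kap = 0 | kap = 1])
  (hein : einstein_metric kap gam)
  (mu : {measure set (g_sigma_algebraType (@open K)) -> \bar R})
  (hmu : riemannian_volume gam mu)
  (W : nat -> R)
  (hW : forall (m : nat) (c : chart R n K) (x : K), atlas c -> cdom c x ->
     Wscal kap gam m c x = W m)
  (hWt : forall (m : nat) (c : chart R n K) (x : K), atlas c -> cdom c x ->
     forall i j : 'I_n,
     Wtens kap gam m c x i j =
       (n%:R - 2 * m%:R) / n%:R * (i == j)%:R * Wscal kap gam m c x)
  (T2 : chart R 2 X -> X -> 'M[R]_2) (hT2 : sym_tensor2 T2) (p : X -> R)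
  (hfield : field_equations a Lam g r gam T2 p)
  (hdec : dominant_energy g tau r gam T2 p)
  (c : chart R 2 X) (hc : atlas c) (f : 'rV[R]_2 -> R)
  (hnull : double_null g tau c f)
  (y : X) (hy : cdom c y) (huntr : untrapped n r c y)
  (xiu xiv : R) (hxiv : 0 <= xiv) (hxiu : xiu <= 0) :
  let M := mass n a Lam kap (fine (mu [set: K])) W g r c in
  0 <= xiv * partial 1 M (ccoord c y) + xiu * partial 0 M (ccoord c y).
Proof.
cbv zeta; set M := mass _ _ _ _ _ _ _ _ _.
(* One fibre point suffices, since [M] and the base components of the stress depend on the base
   alone. *)
pose x0 : K := point.
have [c' hc' hx0] := atlas_cover x0.
pose U := ccoord c @` cdom c.
pose U' := ccoord c' @` cdom c'.
have oU : open U by exact: cimg_open.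
have oU' : open U' by exact: cimg_open.
pose gm := in_coord g c.
pose h u := gm u 0 1.
pose rr u := r (cparam c u).
pose ga := in_coord gam c'.
have gmh u : U u -> gm u = null_mx (h u) /\ h u < 0.
  case=> q cq <-; rewrite /h /gm /in_coord ccoordK // (hnull q cq).1.
  split; last by rewrite mxE /= oppr_lt0 expR_gt0.
  by apply/matrixP => i j; rewrite !mxE.
have gmE u : U u -> gm u = null_mx (h u) by move=> /gmh[].
have h0 u : U u -> h u != 0 by move=> /gmh[_ /ltr0_neq0].
have rr0 u : U u -> rr u != 0 by move=> _; rewrite gt_eqF // hr0.
have Uy : U (ccoord c y) by exists y.
have U'x : U' (ccoord c' x0) by exists x0.
have dh u i : U u -> derivable h u 'e_i.
  by have := hg.1.2 c 0 1 hc; exact: (@smooth_on_derivable _ _ _ _ [::]).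
have drr u i : U u -> derivable rr u 'e_i.
  by have := hr c hc; exact: (@smooth_on_derivable _ _ _ _ [::]).
have ddrr u i j : U u -> derivable (partial j rr) u 'e_i.
  by have := hr c hc; exact: (@smooth_on_derivable _ _ _ _ [:: j]).
have ga_unit x : U' x -> ga x \in unitmx.
  by case=> q cq <-; rewrite /ga /in_coord ccoordK //; exact: riemannian_unitmx hgam _ _.
have ga_sym x : U' x -> (ga x)^T = ga x.
  by case=> q cq <-; rewrite /ga /in_coord ccoordK //; exact: hgam.1.1.2.
have dga x i j k : U' x -> derivable (fun w => ga w i j) x 'e_k.
  by have := hgam.1.2 c' i j hc'; exact: (@smooth_on_derivable _ _ _ _ [::]).
pose z := product_coord c c' y x0.
have zl : lsubmx z = ccoord c y by rewrite /z /product_coord row_mxKl.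
have zr : rsubmx z = ccoord c' x0 by rewrite /z /product_coord row_mxKr.
have Vz : U (lsubmx z) /\ U' (rsubmx z) by rewrite zl zr.
have WE m : Defs.contract m (weyl22 ga kap (rsubmx z)) = W m.
  by rewrite zr; exact: hW.
have W0 m : (n < m.*2)%N -> W m = 0 by move=> nm; rewrite -WE contract_overflow.
have WG : warped_metric g r gam c c' = warped gm rr ga by [].
have GE : warped gm rr ga z = block_mx (null_mx (h (ccoord c y))) 0 0
    (rr (ccoord c y) ^+ 2 *: ga (ccoord c' x0)).
  by rewrite /warped zl zr gmE.
have SE : warped_stress T2 r p gam c c' z =
    block_mx (T2 c y) 0 0 ((r y ^+ 2 * p y) *: gam c' x0).
  by rewrite /warped_stress zl zr !ccoordK.
have TE b e : (warped gm rr ga z *m lovelock (warped gm rr ga) a Lam z) (lshift n b) (lshift n e)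
    = T2 c y b e.
  have := hfield c c' y x0 hc hc' hy hx0; rewrite /= WG -/z SE => ->.
  by rewrite block_mxEul.
have [T00 T01 T10 T11] := lovelock_lower oU oU' gmE h0 rr0 dh drr ddrr ga_unit ga_sym dga Vz WE TE.
have Tsym : T2 c y 1 0 = T2 c y 0 1.
  by have /matrixP/(_ 0 1) := hT2.2 c y hc hy; rewrite mxE.
rewrite zl in T00 T01 T10 T11.
set u := ccoord c y in T00 T01 T10 T11 Uy GE *.
have rru : rr u = r y by rewrite /rr /u ccoordK.
have ry : 0 < r y := hr0 y.
have hu : h u < 0 := (gmh u Uy).2.
have hu0 := h0 u Uy.
have n0 : 0 < n%:R :> R by rewrite ltr0n; lia.
have r1 : 0 < partial 1 rr u.
  have := huntr.1; rewrite /expansion -/u -/rr.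
  by rewrite pmulr_lgt0 ?invr_gt0 // pmulr_rgt0.
have r0 : partial 0 rr u < 0.
  have := huntr.2; rewrite /expansion -/u -/rr.
  by rewrite pmulr_llt0 ?invr_gt0 // pmulr_rlt0.
have gy : g c y = null_mx (h u) by rewrite -gmE // /gm /in_coord /u ccoordK.
have [tau0 tau1] : 0 < tau c y 0 0 /\ 0 < tau c y 1 0.
  have t i := (hnull y hy).2 i; have := t 0; have := t 1.
  rewrite /future_directed gy !bil_null !mxE /= !nmulr_rlt0 // !mulr0 !mulr1 add0r addr0.
  by move=> ? ?; split.
have [E1 E0] : 0 <= T2 c y 1 0 * partial 1 rr u - T2 c y 1 1 * partial 0 rr u /\
    0 <= T2 c y 0 0 * partial 1 rr u - T2 c y 0 1 * partial 0 rr u.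
  (* The observer w = (partial_v r, - partial_u r) is future timelike because
     the surface is untrapped; its energy flux is the claim. *)
  pose w : 'cV[R]_2 := \col_i (if i == 0 then partial 1 rr u else - partial 0 rr u).
  have w0 : w 0 0 = partial 1 rr u by rewrite mxE.
  have w1 : w 1 0 = - partial 0 rr u by rewrite mxE.
  have r0' : 0 < - partial 0 rr u by rewrite oppr_gt0.
  have J := hdec c c' y x0 hc hc' hy hx0.
  rewrite /= -/z WG SE in J; move: J => /(_ (col_mx w 0)).
  rewrite (warped_inv gmE h0 rr0 ga_unit Vz) GE /timelike !bil_block zl -/u.
  rewrite mulmx_block !(mul0mx, mulmx0, addr0, add0r) mul_block_col.
  rewrite !(mul0mx, mulmx0, addr0, add0r) opp_col_mx oppr0.
  set j := - _; move=> J.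
  have /causal_future_null[] : j = 0 \/ causal (null_mx (h u)) j /\
      future_directed (null_mx (h u)) (tau c y) j.
  - case: J => [||J|[[jn0 jj] jt]].
    + by rewrite bil_null w0 w1 nmulr_rlt0 // addr_gt0 // mulr_gt0.
    + by rewrite /future_directed bil_block bil_null w0 w1 nmulr_rlt0 // addr_gt0 // mulr_gt0.
    + by left; have /eq_col_mx[] : col_mx j 0 = col_mx 0 (0 : 'cV_n) by rewrite J col_mx0.
    right; split; last by move: jt; rewrite /future_directed bil_block.
    split; last by move: jj; rewrite bil_block.
    by apply: contra jn0 => /eqP ->; rewrite col_mx0.
  - exact: hu.
  - exact: tau0.
  - exact: tau1.
  (* Raising with the null metric flips the index, so the components of the flux are the two claimed
     expressions times the positive number [- 1 / h]. *)
  have jE i : j i 0 = - (h u)^-1 * (T2 c y (rev_ord i) 0 * partial 1 rr u -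
      T2 c y (rev_ord i) 1 * partial 0 rr u).
    rewrite /j !mxE sum_ord2 !mxE !sum_ord2 !mxE /=.
    by elim/ord2P: i; rewrite ?(rev_ord0_2, rev_ord1_2) /=; ring.
  have k0 : 0 < - (h u)^-1 by rewrite oppr_gt0 invr_lt0.
  by rewrite !jE !(rev_ord0_2, rev_ord1_2) !pmulr_rge0.
pose kappa v := kap - null_grad h rr v.
have gradE v : U v -> grad_sq gm rr v = null_grad h rr v.
  move=> Uv; rewrite /grad_sq gmE // invmx_null ?h0 // !sum_ord2 !mxE /= /null_grad.
  by ring.
(* Since [D_i (Dr)^2 = 2 D^c r D_i D_c r], the 2 cancels the half in [is_partial_mass], and the
   derivative of [h] becomes the Christoffel term of [hess]. *)
have PM i : partial i M u = fine (mu [set: K]) * rr u ^+ n *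
    (trace_sum n W a Lam (rr u) (kappa u) * partial i rr u -
     hess_sum n W a (rr u) (kappa u) *
       (hess h rr i 0 u * partial 1 rr u + partial 0 rr u * hess h rr i 1 u) / h u).
  rewrite (@partial_near _ _ _ U _ (fun v =>
      mass_value n a Lam (fine (mu [set: K])) W (rr v) (kappa v))) //.
    have Dk : is_derive u 'e_i kappa (0 + -1 *
        (2 * partial 0 rr u * partial 1 rr u * (- h u ^- 2 * partial i h u) +
         (h u)^-1 * (2 * partial 0 rr u * partial i (partial 1 rr) u +
                     partial 1 rr u * (2 * partial i (partial 0 rr) u)))).
      rewrite (_ : kappa = (fun v => kap + -1 * null_grad h rr v)); last first.
        by apply/funext => v; rewrite mulN1r.
      apply: is_partialD.
      apply: is_partialMl; apply: is_partialM; last first.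
        by apply: is_partialV => //; apply: is_partial; exact: dh.
      apply: is_partialM; last by apply: is_partial; exact: ddrr.
      by apply: is_partialMl; apply: is_partial; exact: ddrr.
    rewrite (partialE (is_partial_mass _ _ _ W0 (rr0 u Uy) (is_partial (drr u i Uy)) Dk)).
    rewrite /hess; move: (trace_sum _ _ _ _ _ _) (hess_sum _ _ _ _ _) (_ ^+ n) (fine _) hu0.
    move=> A B C D hu0.
    move: (h u) (partial 0 rr u) (partial 1 rr u) hu0 => h' q0 q1 hu0.
    by elim/ord2P: i {Dk}; rewrite /=;
      move: (partial _ h u) (partial _ (partial 0 _) u) (partial _ (partial 1 _) u) => ? ? ?; field.
  by move=> v Uv; rewrite /M mass_valueE gradE.
have Vge : 0 <= fine (mu [set: K]) * rr u ^+ n.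
  by rewrite mulr_ge0 ?fine_ge0 // exprn_ge0 // rru ltW.
have kz : kap - null_grad h rr u = kappa u by [].
rewrite !PM; rewrite kz in T00 T01 T10 T11.
have hV : - (h u)^-1 > 0 by rewrite oppr_gt0 invr_lt0.
have P1 : 0 <= fine (mu [set: K]) * rr u ^+ n *
    (trace_sum n W a Lam (rr u) (kappa u) * partial 1 rr u -
     hess_sum n W a (rr u) (kappa u) *
       (hess h rr 1 0 u * partial 1 rr u + partial 0 rr u * hess h rr 1 1 u) / h u).
  (* Symmetry of [T2] selects the mixed component whose formula contains [hess 1 0], the order of
     derivatives that occurs in [PM]. *)
  apply: mulr_ge0 => //; have := mulr_ge0 (ltW hV) E1; rewrite Tsym T01 T11.
  move: (trace_sum _ _ _ _ _ _) (hess_sum _ _ _ _ _) (h u) hu0 hess => A B h' hu0 H.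
  set P := (X in 0 <= X -> _); set Q := (X in _ -> 0 <= X); suff -> : P = Q by [].
  by rewrite /P /Q; field.
have P0 : fine (mu [set: K]) * rr u ^+ n *
    (trace_sum n W a Lam (rr u) (kappa u) * partial 0 rr u -
     hess_sum n W a (rr u) (kappa u) *
       (hess h rr 0 0 u * partial 1 rr u + partial 0 rr u * hess h rr 0 1 u) / h u) <= 0.
  rewrite -oppr_ge0 -mulrN; apply: mulr_ge0 => //.
  have := mulr_ge0 (ltW hV) E0; rewrite -Tsym T10 T00.
  move: (trace_sum _ _ _ _ _ _) (hess_sum _ _ _ _ _) (h u) hu0 hess => A B h' hu0 H.
  set P := (X in 0 <= X -> _); set Q := (X in _ -> 0 <= X); suff -> : P = Q by [].
  by rewrite /P /Q; field.
by apply: addr_ge0; [exact: mulr_ge0|exact: mulr_le0].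
Qed.
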